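(* Assume AS.1, AS.2, AS.3, AS.4, AS.5 and AS.6 (with constants $\omega\in(0,1)$ and $\pi_S^{(1)}>0$), let $\delta_1\in(0,1)$ and apply the SKOFFAR$p$ algorithm to $\min_{x\in\mathbb R^n}f(x)$. Define $$\kappa_{\rm SKOFFARp}=\frac{4\big[L_p+(p+1)!\,(f_{\max}-f_{\rm low})\big]}{\vartheta\nu_0\,\omega^{(p+1)/p}(1-\delta_1)\pi_S^{(1)}},$$ $$k_*=\left\lceil\frac{2L_p\,\epsilon^{-(p+1)/p}}{\vartheta\nu_0\,\omega^{(p+1)/p}}\right\rceil,\qquad k_\diamond=\left\lceil\frac{k_*}{(1-\delta_1)\pi_S^{(1)}}\right\rceil.$$ Then $$\mathbb P\Big[N_1(\epsilon)\le\kappa_{\rm SKOFFARp}\,\epsilon^{-(p+1)/p}+4\Big]\ge\Big(1-e^{-\frac{\delta_1^2}{2}\pi_S^{(1)}k_\diamond}\Big)^2.$$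
   Context: Let $f:\mathbb{R}^n\to\mathbb{R}$ and $p\ge1$ an integer; $\|\cdot\|$ is the Euclidean norm for vectors, the spectral norm for matrices and the induced (subordinate) norm for tensors; $T[d]^i$ denotes a symmetric $i$-tensor applied to $i$ copies of $d$. Assumptions: AS.1: $f$ is $p$ times continuously differentiable on $\mathbb{R}^n$. AS.2: there is $f_{\rm low}$ with $f(x)\ge f_{\rm low}$ for all $x$. AS.3: there is $L_p\ge 0$ with $\|\nabla^p f(x)-\nabla^p f(y)\|\le L_p\|x-y\|$ for all $x,y$. AS.4: there is $\kappa_g\ge0$ with $\|\nabla f(x)\|\le\kappa_g$ for all $x$. AS.5: if $p>1$ there is $\kappa_{\rm high}\ge0$ with $\min_{\|d\|\le1}\nabla^i f(x)[d]^i\ge-\kappa_{\rm high}$ for all $x$ and $i\in\{2,\dots,p\}$ (set $\kappa_{\rm high}=0$ if $p=1$). For $x,s\in\mathbb{R}^n$ let $T_{f,p}(x,s)=f(x)+\sum_{i=1}^p\frac{1}{i!}\nabla^i f(x)[s]^i$. Write $g_k=\nabla f(x_k)$. The SKOFFAR$p$ algorithm: given $x_0\in\mathbb{R}^n$, $\nu_0>0$, $\epsilon\in(0,1]$, $\theta>1$, $\mu_{-1}\ge 0$, $\vartheta\in(0,1)$ and a fixed distribution $\mathcal S$ of $\ell\times n$ random matrices ($\ell<n$), for $k=0,1,2,\dots$: (i) if $k=0$ set $\sigma_0=\nu_0$; otherwise choose $\sigma_k\in[\vartheta\nu_k,\max(\nu_k,\mu_k)]$, where $\mu_k=\max\Big[\mu_{k-1},\frac{\|S_{k-1}g_k\|-\|\nabla_{\hat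 s}\widehat T_{k-1}(\hat s_{k-1})\|}{\kappa_{S,k-1}\|s_{k-1}\|^p}\Big]$ for some number $\kappa_{S,k-1}\ge\|S_{k-1}\|$; (ii) draw $S_k\in\mathbb{R}^{\ell\times n}$ from $\mathcal S$, define for $\hat s\in\mathbb{R}^\ell$ the sketched Taylor model $\widehat T_k(\hat s)=T_{f,p}(x_k,S_k^T\hat s)$ and the sketched model $\widehat m_k(\hat s)=\widehat T_k(\hat s)+\frac{\sigma_k}{(p+1)!}\|S_k^T\hat s\|^{p+1}$, and compute $\hat s_k\in\mathbb{R}^\ell$ with $\widehat m_k(\hat s_k)<\widehat m_k(0)$ and $\|\nabla_{\hat s}\widehat T_k(\hat s_k)\|\le\theta\frac{\sigma_k}{p!}\|S_k^T\hat s_k\|^{p-1}\|S_kS_k^T\hat s_k\|$; set $s_k=S_k^T\hat s_k$; (iii) set $x_{k+1}=x_k+s_k$ and $\nu_{k+1}=\nu_k+\nu_k\|s_k\|^{p+1}$. Because the $S_k$ are random, the iterates $x_k$, steps $s_k$ and parameters $\sigma_k,\nu_k$ are random variables. $N_1(\epsilon)=\min\{k\in\mathbb N:\|g_k\|\le\epsilon\}$ (possibly $+\infty$). For $\omega\in(0,1)$, an iteration $k\in\{0,\dots,N_1(\epsilon)-2\}$ is called $\omega$-true if $\|s_k\|^p\ge\omega\epsilon$. Constants: $\eta=\sum_{i=2}^p\Big[\frac{\kappa_{\rm high}(p+1)!}{i!\,\vartheta\nu_0}\Big]^{1/(p-i+1)}$ ($\eta=0$ if $p=1$); $\nu_{\max}=\frac{2L_p}{\vartheta}\Big[1+\Big(2\eta+2\big(\frac{(p+1)!\kappa_g}{\vartheta\nu_0}\big)^{1/p}\Big)^{p+1}\Big]$;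 $f_{\max}=f(x_0)+\frac{1}{(p+1)!}\Big(\frac{L_p}{\nu_0}\nu_{\max}+\vartheta\nu_0\Big)$; $\sigma_{\max}=\max\Big[\frac{2(p+1)!}{\vartheta}\big(f_{\max}-f_{\rm low}\big)+\nu_{\max},\ \mu_{-1},\ \frac{2L_p}{\vartheta},\ \nu_0\Big]$. AS.6: there exist $\omega\in(0,1)$ and $\pi_S^{(1)}>0$ such that, for $S_k$ drawn from $\mathcal S$, $\mathbb P[\text{iteration }k\text{ is }\omega\text{-true}\mid x_k=\bar x_k,\ \sigma_k=\bar\sigma_k]\ge\pi_S^{(1)}$ for every $\bar x_k\in\mathbb R^n$, every $\bar\sigma_k\in[\vartheta\nu_0,\sigma_{\max}]$ and every $k\in\{0,\dots,N_1(\epsilon)-2\}$; moreover, the event that iteration $k$ is $\omega$-true is conditionally independent of the events that iterations $0,\dots,k-1$ are $\omega$-true, given $x_k=\bar x_k$ and $\sigma_k=\bar\sigma_k$. *)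

(* Defs.v *)
From HB Require Import structures.
From mathcomp Require Import all_boot all_order all_algebra.
From mathcomp Require Import all_classical all_reals all_analysis.
Import Order.TTheory GRing.Theory Num.Theory.
Import numFieldNormedType.Exports.

Set Implicit Arguments.
Unset Strict Implicit.
Unset Printing Implicit Defensive.

Local Open Scope classical_set_scope.
Local Open Scope ring_scope.

Section SKOFFAR.
Context {R : realType}.

Definition enorm {m : nat} (v : 'cV[R]_m) : R :=
  Num.sqrt (\sum_(i < m) v i 0 ^+ 2).

(* spectral (operator) norm of a matrix, induced by the Euclidean norms;
   valued in \bar R so that it is never silently truncated *)
Definition opnorm {a b : nat} (A : 'M[R]_(a, b)) : \bar R :=
  ereal_sup [set (enorm (A *m v))%:E | v in [set v : 'cV[R]_b | enorm v <= 1]].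

(* induced (subordinate) norm of an i-linear form F (given as a function of
   the list of its i arguments) *)
Definition tnorm {m : nat} (F : seq 'cV[R]_m -> R) (i : nat) : \bar R :=
  ereal_sup [set (`|F vs|)%:E | vs in
     [set vs : seq 'cV[R]_m | size vs = i /\ all (fun v => enorm v <= 1) vs]].

(* dderiv [:: v1; ...; vi] f x = nabla^i f(x)[v1, ..., vi]
   (iterated directional derivatives D_{v1} ... D_{vi} f at x) *)
Fixpoint dderiv {m : nat} (vs : seq 'cV[R]_m) (f : 'cV[R]_m -> R)
  : 'cV[R]_m -> R :=
  match vs with
  | [::] => f
  | v :: vs' => fun x => derive (dderiv vs' f) x v
  end.

Definition grad {m : nat} (h : 'cV[R]_m -> R) (x : 'cV[R]_m) : 'cV[R]_m :=
  \col_(j < m) dderiv [:: delta_mx j 0] h x.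

Definition Cp {m : nat} (p : nat) (f : 'cV[R]_m -> R) : Prop :=
  forall vs : seq 'cV[R]_m, (size vs <= p)%N ->
    continuous (dderiv vs f) /\
    ((size vs < p)%N -> forall x v, derivable (dderiv vs f) x v).

Definition taylor {m : nat} (f : 'cV[R]_m -> R) (p : nat) (x s : 'cV[R]_m) : R :=
  f x + \sum_(1 <= i < p.+1) (i`!%:R)^-1 * dderiv (nseq i s) f x.

Definition AS1 {m : nat} (p : nat) (f : 'cV[R]_m -> R) := Cp p f.
Definition AS2 {m : nat} (f : 'cV[R]_m -> R) (flow : R) :=
  forall x, flow <= f x.
Definition AS3 {m : nat} (p : nat) (f : 'cV[R]_m -> R) (Lp : R) :=
  forall x y, (tnorm (fun vs => (dderiv vs f x - dderiv vs f y)%R) p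
               <= (Lp * enorm (x - y))%:E)%E.
Definition AS4 {m : nat} (f : 'cV[R]_m -> R) (kg : R) :=
  forall x, enorm (grad f x) <= kg.
Definition AS5 {m : nat} (p : nat) (f : 'cV[R]_m -> R) (khigh : R) :=
  forall x (i : nat), (2 <= i <= p)%N ->
    forall d : 'cV[R]_m, enorm d <= 1 -> - khigh <= dderiv (nseq i d) f x.

Definition That {n l : nat} (f : 'cV[R]_n -> R) (p : nat) (xk : 'cV[R]_n)
  (Sk : 'M[R]_(l, n)) (sh : 'cV[R]_l) : R :=
  taylor f p xk (Sk^T *m sh).
Definition mhat {n l : nat} (f : 'cV[R]_n -> R) (p : nat) (xk : 'cV[R]_n)
  (Sk : 'M[R]_(l, n)) (sigk : R) (sh : 'cV[R]_l) : R :=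
  That f p xk Sk sh + sigk / (p.+1)`!%:R * enorm (Sk^T *m sh) ^+ p.+1.

(* mu k stands for mu_k for k >= 1 and mu 0 := mu_{-1};
   kS k is the number kappa_{S,k} >= ||S_k||. *)
Definition skoffar_run {n l : nat} (f : 'cV[R]_n -> R) (p : nat)
  (x0 : 'cV[R]_n) (nu0 theta mum1 vartheta : R)
  (x : nat -> 'cV[R]_n) (S : nat -> 'M[R]_(l, n)) (sh : nat -> 'cV[R]_l)
  (sigma nu mu kS : nat -> R) : Prop :=
  let s k := (S k)^T *m sh k in
  [/\ x 0 = x0, nu 0 = nu0, sigma 0 = nu0, mu 0 = mum1 &
   forall k : nat,
   [/\ (opnorm (S k) <= (kS k)%:E)%E,
       mu k.+1 = Num.max (mu k)
         ((enorm (S k *m grad f (x k.+1))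
           - enorm (grad (That f p (x k) (S k)) (sh k)))
          / (kS k * enorm (s k) ^+ p)),
       vartheta * nu k.+1 <= sigma k.+1 <= Num.max (nu k.+1) (mu k.+1),
       mhat f p (x k) (S k) (sigma k) (sh k) < mhat f p (x k) (S k) (sigma k) 0 &
     [/\ enorm (grad (That f p (x k) (S k)) (sh k))
         <= theta * (sigma k / p`!%:R) * enorm (s k) ^+ p.-1
            * enorm (S k *m (S k)^T *m sh k),
       x k.+1 = x k + s k &
       nu k.+1 = nu k + nu k * enorm (s k) ^+ p.+1]]].

(* N_1(eps) = min {k | ||g_k|| <= eps}, +oo if there is none *)
Definition N1 {n : nat} (f : 'cV[R]_n -> R) (x : nat -> 'cV[R]_n) (eps : R)
  : \bar R :=
  ereal_inf [set (k%:R)%:E | k in [set k : nat | enorm (grad f (x k)) <= eps]].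

Definition eta_c (p : nat) (khigh vartheta nu0 : R) : R :=
  \sum_(2 <= i < p.+1)
     ((khigh * (p.+1)`!%:R) / (i`!%:R * vartheta * nu0)) `^ ((p - i).+1%:R)^-1.

Definition nu_max (p : nat) (Lp kg khigh vartheta nu0 : R) : R :=
  (2 * Lp / vartheta) *
  (1 + (2 * eta_c p khigh vartheta nu0
        + 2 * (((p.+1)`!%:R * kg) / (vartheta * nu0)) `^ (p%:R)^-1) ^+ p.+1).

Definition f_max (fx0 : R) (p : nat) (Lp kg khigh vartheta nu0 : R) : R :=
  fx0 + ((p.+1)`!%:R)^-1 *
        (Lp / nu0 * nu_max p Lp kg khigh vartheta nu0 + vartheta * nu0).

Definition sigma_max (fx0 flow : R) (p : nat) (Lp kg khigh vartheta nu0 mum1 : R)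
  : R :=
  Num.max (2 * (p.+1)`!%:R / vartheta
             * (f_max fx0 p Lp kg khigh vartheta nu0 - flow)
           + nu_max p Lp kg khigh vartheta nu0)
  (Num.max mum1 (Num.max (2 * Lp / vartheta) nu0)).

Definition kappa_SKOFFARp (fx0 flow : R) (p : nat)
  (Lp kg khigh vartheta nu0 omega delta1 piS : R) : R :=
  4 * (Lp + (p.+1)`!%:R * (f_max fx0 p Lp kg khigh vartheta nu0 - flow))
  / (vartheta * nu0 * omega `^ (p.+1%:R / p%:R) * (1 - delta1) * piS).

Definition k_star (p : nat) (Lp vartheta nu0 omega eps : R) : int :=
  Num.ceil (2 * Lp * eps `^ (- (p.+1%:R / p%:R))
            / (vartheta * nu0 * omega `^ (p.+1%:R / p%:R))).

Definition k_diamond (p : nat) (Lp vartheta nu0 omega eps delta1 piS : R) : int :=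
  Num.ceil ((k_star p Lp vartheta nu0 omega eps)%:~R / ((1 - delta1) * piS)).

Section Prob.
Context {d : measure_display} {T : measurableType d} (P : probability T R).

Definition condprob_version (G : set (set T)) (A : set T) (q : T -> R) : Prop :=
  (forall B : set R, measurable B -> G (q @^-1` B)) /\
  (forall C : set T, G C -> P (A `&` C) = (\int[P]_(w in C) (q w)%:E)%E).

Definition cond_indep (G : set (set T)) (A E : set T) : Prop :=
  exists qA qE qAE : T -> R,
    [/\ condprob_version G A qA, condprob_version G E qE,
        condprob_version G (A `&` E) qAE &
        {ae P, forall w, qAE w = qA w * qE w}].

Definition sigma_gen_xs {n : nat} (xk : T -> 'cV[R]_n) (sigk : T -> R)
  : set (set T) :=
  <<s [set A : set T | (exists (i : 'I_n) (B : set R),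
                           measurable B /\ A = (fun w => xk w i 0) @^-1` B)
                    \/ (exists B : set R, measurable B /\ A = sigk @^-1` B)] >>.

Definition omega_true {n l : nat} (f : 'cV[R]_n -> R) (p : nat)
  (x : T -> nat -> 'cV[R]_n) (S : T -> nat -> 'M[R]_(l, n))
  (sh : T -> nat -> 'cV[R]_l) (eps omega : R) (k : nat) : set T :=
  [set w | ((k.+2)%:R%:E <= N1 f (x w) eps)%E /\
           omega * eps <= enorm ((S w k)^T *m sh w k) ^+ p].

Definition AS6 {n l : nat} (f : 'cV[R]_n -> R) (p : nat)
  (x : T -> nat -> 'cV[R]_n) (S : T -> nat -> 'M[R]_(l, n))
  (sh : T -> nat -> 'cV[R]_l) (sigma : T -> nat -> R)
  (eps omega piS vartheta nu0 sigmax : R) : Prop :=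
  let Tk := omega_true f p x S sh eps omega in
  let Gk k := sigma_gen_xs (fun w => x w k) (fun w => sigma w k) in
  (forall k : nat, exists q : T -> R,
      condprob_version (Gk k) (Tk k) q /\
      forall w, vartheta * nu0 <= sigma w k <= sigmax ->
                ((k.+2)%:R%:E <= N1 f (x w) eps)%E -> piS <= q w)
  /\
  (forall (k : nat) (E : set T),
      <<s [set Tk j | j in [set j : nat | (j < k)%N]] >> E ->
      cond_indep (Gk k) (Tk k) E).

(* the S_k are drawn independently from one fixed distribution:
   identically distributed and mutually independent (on rectangles, which
   generate the Borel sigma-algebra of matrices) *)
Definition iid_sketches {l n : nat} (S : T -> nat -> 'M[R]_(l, n)) : Prop :=
  (forall (k : nat) (B : 'I_l -> 'I_n -> set R),
      (forall i j, measurable (B i j)) ->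
      P [set w | forall i j, B i j (S w k i j)]
      = P [set w | forall i j, B i j (S w 0 i j)])
  /\
  (forall (k : nat) (B : nat -> 'I_l -> 'I_n -> set R),
      (forall t i j, measurable (B t i j)) ->
      P [set w | forall (t : 'I_k.+1) i j, B t i j (S w t i j)]
      = (\prod_(t < k.+1) P [set w | forall i j, B t i j (S w t i j)])%E).

End Prob.

End SKOFFAR.

(* Main.v *)
Require Import Defs.
From HB Require Import structures.
From mathcomp Require Import all_boot all_order all_algebra.
From mathcomp Require Import all_classical all_reals all_analysis.
From mathcomp Require Import measurable_realfun.
From mathcomp Require Import ring lra zify.
Set Implicit Arguments.
Unset Strict Implicit.
Unset Printing Implicit Defensive.
Import Order.TTheory GRing.Theory Num.Theory.
Import numFieldNormedType.Exports.
Local Open Scope classical_set_scope.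
Local Open Scope ring_scope.

(** The quantity nu is multiplied by 1 + ||s_k||^(p+1) at every
    step, so every omega-true iteration adds at least
    nu0 (omega eps)^((p+1)/p) to it. Hence, up to one iteration, at most
    2 Lp / (vartheta nu0 (omega eps)^((p+1)/p)) omega-true iterations happen
    before nu exceeds 2 Lp / vartheta; until then f stays below f_max. From
    there on sigma >= 2 Lp, so each step decreases f by at least
    sigma ||s_k||^(p+1) / (2 (p+1)!), and boundedness below of f limits both
    the remaining omega-true iterations and the further growth of nu. The
    bound on the gradient error of the Taylor model controls mu, whence
    sigma <= sigma_max on every realization, and AS6 applies as long as N1 is
    not reached.

    On the probabilistic side, conditional independence makes
    E[(1 - delta1)^#true; N1 > k] decay geometrically in k. As the number of
    omega-true iterations is bounded on every realization, this single Chernoff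
    bound, taken at K = floor(kappa eps^(-(p+1)/p) + 4) >= k_diamond, gives
    P[N1 > K] <= E with E := exp(- delta1^2 / 2 * piS * k_diamond), and
    1 - E >= (1 - E)^2. *)

(** * Directional derivatives *)

(** Both sides are limits of one and the same difference quotient. Directional derivatives thereby
    become derivatives in one real variable, where the mean value theorem applies. *)
Lemma is_derive_lineE (R : realType) (V : normedModType R) (F : V -> R)
    (x v : V) (t D : R) :
  is_derive t (1 : R) (fun u : R => F (x + u *: v)) D <->
  is_derive (x + t *: v) v F D.
Proof.
have E : (fun h : R => h^-1 *: (((fun u : R => F (x + u *: v)) \o shift t)
            (h *: (1 : R)) - F (x + t *: v))) =
         (fun h : R => h^-1 *: ((F \o shift (x + t *: v)) (h *: v)
            - F (x + t *: v))).
  apply/funext => h; congr (_ *: (F _ - _)).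
  by rewrite /shift/= -[h *: (1 : R)]/(h * 1) mulr1 scalerDl addrCA.
by split=> -[]; rewrite /derivable /derive -?E ?E => ? ?; split;
  rewrite /derivable /derive -?E ?E.
Qed.

Lemma MVT_line (R : realType) (V : normedModType R) (F : V -> R) (x v : V) :
  (forall y, derivable F y v) ->
  exists2 t : R, 0 <= t <= 1 & F (x + v) - F x = 'D_v F (x + t *: v).
Proof.
move=> dF.
have dL t : is_derive t (1 : R) (fun u : R => F (x + u *: v))
    ('D_v F (x + t *: v)).
  by apply/is_derive_lineE; exact: derivableP.
have cL : {within `[0, 1 : R], continuous (fun u : R => F (x + u *: v))}.
  apply: derivable_within_continuous => t _.
  by have [] := dL t.
have [t t01] := MVT_segment ler01 (fun t _ => dL t) cL.
rewrite scale1r scale0r addr0 subr0 mulr1 => ->.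
by exists t => //; move: t01; rewrite in_itv.
Qed.

Lemma is_derive_scale (R : realType) (V : normedModType R) (F : V -> R)
    (x v : V) (a : R) :
  derivable F x v -> is_derive x (a *: v) F (a * 'D_v F x).
Proof.
move=> dF.
(* Only for a nonzero [a] does the substitution h -> h a preserve punctured neighbourhoods of 0. *)
have [->|a0] := eqVneq a 0; first by rewrite scale0r mul0r; exact: is_derive0.
have Ma : (fun h : R => h * a) @ 0^' --> 0^'.
  move=> A A0.
  have /(_ 0) := @mulrr_continuous R a; rewrite /continuous_at mul0r => ca.
  have := ca [set y | y != 0 -> A y] A0.
  by apply: (@filterS _ (nbhs (0 : R))) => h /= hA h0; apply: hA; rewrite mulf_neq0.
have L : (fun h : R => h^-1 *: ((F \o shift x) (h *: (a *: v)) - F x)) @ 0^'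
   --> a * 'D_v F x.
  have -> : (fun h : R => h^-1 *: ((F \o shift x) (h *: (a *: v)) - F x)) =
     (fun h : R => a *: ((h * a)^-1 *: ((F \o shift x) ((h * a) *: v) - F x))).
    apply/funext => h; rewrite !scalerA /=; congr (_ *: (_ - _)).
    by rewrite invfM mulrCA mulfV// mulr1.
  have C := cvg_comp _ _ Ma dF.
  exact: (cvgZl_tmp (k := a) C).
by split; [apply/cvg_ex; eexists; exact: L | exact/cvg_lim].
Qed.

Lemma addrCK (V : zmodType) (x y : V) : x + y - x = y.
Proof. by rewrite addrC addKr. Qed.

(** A form of continuity that lets a single step length h serve several functions at once; r will be
    the total length of the directions involved. *)
Lemma continuous_scaled_ball (R : realType) (V : normedModType R) (G : V -> R)
    (x : V) (r e : R) :
  {for x, continuous G} -> 0 <= r -> 0 < e ->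
  exists2 c : R, 0 < c & forall (h : R) (y : V),
    h <= c -> `|y - x| <= h * r -> `|G y - G x| <= e.
Proof.
move=> cG r0 e0.
have /cvgrPdist_le /(_ e e0) := cG.
move=> /nbhs_ballP[b /= b0 Hb].
have b20 : 0 < b / (r + 1) by rewrite divr_gt0// ltr_wpDl.
exists (b / (r + 1)) => // h y hb yh.
rewrite distrC; apply: Hb; rewrite -ball_normE/= distrC.
apply: (le_lt_trans yh).
apply: (le_lt_trans (ler_wpM2r r0 hb)).
rewrite -mulrA gtr_pMr// ltr_pdivrMl ?ltr_wpDl// mulr1.
by rewrite ltrDl.
Qed.

Lemma dist3_le (R : realFieldType) (a b a' b' s e : R) :
  `|a - a'| <= e / 3 -> `|b - b'| <= e / 3 -> `|a + b - s| <= e / 3 ->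
  `|s - (a' + b')| <= e.
Proof.
rewrite !ler_norml => /andP[? ?] /andP[? ?] /andP[? ?].
by apply/andP; split; lra.
Qed.

Lemma dist2_le (R : realFieldType) (a b c e : R) :
  `|a - b| <= e / 2 -> `|a - c| <= e / 2 -> `|b - c| <= e.
Proof.
rewrite !ler_norml => /andP[? ?] /andP[? ?].
by apply/andP; split; lra.
Qed.

(** [Cp] speaks of directional derivatives only, so additivity in the direction has to be proved.
    The increment along h (u + v) is the increment along h u followed by that along h v; the mean
    value theorem makes each of the three h times a directional derivative near x, and continuity
    carries these values to x. *)
Lemma deriveDv (R : realType) (V : normedModType R) (F : V -> R) (x u v : V) :
  (forall y w, derivable F y w) -> (forall w, continuous ('D_w F)) ->
  'D_(u + v) F x = 'D_u F x + 'D_v F x.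
Proof.
move=> dF cF; apply/eqP; rewrite -subr_eq0 -normr_le0; apply/ler_addgt0Pr => e e0; rewrite add0r.
pose r := `|u| + `|v|.
have r0 : 0 <= r by rewrite addr_ge0.
have e3 : 0 < e / 3 by lra.
have [c1 c10 Hu] := @continuous_scaled_ball R V _ x r _ (cF u x) r0 e3.
have [c2 c20 Hv] := @continuous_scaled_ball R V _ x r _ (cF v x) r0 e3.
have [c3 c30 Huv] := @continuous_scaled_ball R V _ x r _ (cF (u + v) x) r0 e3.
pose h := Num.min c1 (Num.min c2 c3).
have h0 : 0 < h by rewrite !lt_min c10 c20.
have h1 : h <= c1 by rewrite ge_min lexx.
have h2 : h <= c2 by rewrite !ge_min lexx !orbT.
have h3 : h <= c3 by rewrite !ge_min lexx !orbT.
move: h h0 h1 h2 h3 => h h0 h1 h2 h3.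
have sc w y : 'D_(h *: w) F y = h * 'D_w F y.
  by have [_ ->] := @is_derive_scale _ _ F y w h (dF _ _).
have [t1 /andP[t10 t11] E1] := @MVT_line _ _ F x (h *: u) (dF ^~ _).
have [t2 /andP[t20 t21] E2] := @MVT_line _ _ F (x + h *: u) (h *: v) (dF ^~ _).
have [t3 /andP[t30 t31] E3] := @MVT_line _ _ F x (h *: (u + v)) (dF ^~ _).
rewrite !sc in E1 E2 E3.
have b1 : `|x + t1 *: (h *: u) - x| <= h * r.
  rewrite addrCK !normrZ !ger0_norm ?(ltW h0)//.
  by rewrite mulrCA ler_pM2l// (le_trans (ler_piMl _ _))// lerDl.
have b2 : `|x + h *: u + t2 *: (h *: v) - x| <= h * r.
  rewrite -(addrA x) addrCK (le_trans (ler_normD _ _))//.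
  rewrite !normrZ !ger0_norm ?(ltW h0)// mulrDr lerD2l mulrCA ler_pM2l//.
  by rewrite ler_piMl.
have b3 : `|x + t3 *: (h *: (u + v)) - x| <= h * r.
  rewrite addrCK !normrZ !ger0_norm ?(ltW h0)//.
  by rewrite mulrCA ler_pM2l// (le_trans (ler_piMl _ _))// ler_normD.
have := Huv _ _ h3 b3.
have : 'D_(u + v) F (x + t3 *: (h *: (u + v))) =
       'D_u F (x + t1 *: (h *: u)) + 'D_v F (x + h *: u + t2 *: (h *: v)).
  apply: (mulfI (lt0r_neq0 h0)); rewrite mulrDr -E1 -E2 -E3 scalerDr addrA.
  by rewrite [RHS]addrC addrA subrK.
move=> ->; exact: dist3_le (Hu _ _ h1 b1) (Hv _ _ h2 b2).
Qed.

(* Schwarz: both mixed derivatives are limits of the same double difference *)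
Lemma deriveC (R : realType) (V : normedModType R) (F : V -> R) (x u v : V) :
  (forall y w, derivable F y w) -> (forall y w z, derivable ('D_w F) y z) ->
  continuous ('D_u ('D_v F)) -> continuous ('D_v ('D_u F)) ->
  'D_u ('D_v F) x = 'D_v ('D_u F) x.
Proof.
move=> dF d2F cuv cvu.
apply/eqP; rewrite -subr_eq0 -normr_le0; apply/ler_addgt0Pr => e e0; rewrite add0r.
pose r := `|u| + `|v|.
have r0 : 0 <= r by rewrite addr_ge0.
have e2 : 0 < e / 2 by lra.
have [c1 c10 Hu] := @continuous_scaled_ball R V _ x r _ (cuv x) r0 e2.
have [c2 c20 Hv] := @continuous_scaled_ball R V _ x r _ (cvu x) r0 e2.
pose h := Num.min c1 c2.
have h0 : 0 < h by rewrite !lt_min c10 c20.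
have h1 : h <= c1 by rewrite ge_min lexx.
have h2 : h <= c2 by rewrite !ge_min lexx !orbT.
move: h h0 h1 h2 => h h0 h1 h2.
(* The double difference is the increment along h a of [G], itself a difference along h b. One mean
   value along a and one along b produce y. *)
have key (a b : V) : exists2 y : V, `|y - x| <= h * (`|a| + `|b|) &
   F (x + h *: a + h *: b) - F (x + h *: a) - (F (x + h *: b) - F x) =
   h * (h * 'D_b ('D_a F) y).
  pose G (y : V) := F (y + h *: b) - F y.
  have dsh y : is_derive y (h *: a) (fun y => F (y + h *: b))
     ('D_(h *: a) F (y + h *: b)).
    have E : (fun k : R => k^-1 *: (((fun y => F (y + h *: b)) \o shift y)
            (k *: (h *: a)) - F (y + h *: b))) =
         (fun k : R => k^-1 *: ((F \o shift (y + h *: b)) (k *: (h *: a))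
            - F (y + h *: b))).
      by apply/funext => k; rewrite /shift/= addrA.
    by split; rewrite /derivable /derive E//; exact: dF.
  have dG y : is_derive y (h *: a) G
      ('D_(h *: a) F (y + h *: b) - 'D_(h *: a) F y).
    exact: (@is_deriveB _ _ _ (fun z => F (z + h *: b)) F y (h *: a) _ _
      (dsh y) (derivableP (dF y _))).
  have dG' y : derivable G y (h *: a) by have [] := dG y.
  have [t1 /andP[t10 t11] E1] := @MVT_line _ _ G x (h *: a) dG'.
  have [_ E1'] := dG (x + t1 *: (h *: a)).
  have sc y : 'D_(h *: a) F y = h * 'D_a F y.
    by have [_ ->] := @is_derive_scale _ _ F y a h (dF _ _).
  have sc2 y : 'D_(h *: b) ('D_a F) y = h * 'D_b ('D_a F) y.
    by have [_ ->] := @is_derive_scale _ _ ('D_a F) y b h (d2F _ _ _).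
  have [t2 /andP[t20 t21] E2] := @MVT_line _ _ ('D_a F) (x + t1 *: (h *: a))
     (h *: b) (fun y => d2F y a _).
  exists (x + t1 *: (h *: a) + t2 *: (h *: b)).
    rewrite -(addrA x) addrCK (le_trans (ler_normD _ _))//.
    rewrite !normrZ !ger0_norm ?(ltW h0)// mulrDr lerD//.
      by rewrite mulrCA ler_pM2l// ler_piMl.
    by rewrite mulrCA ler_pM2l// ler_piMl.
  move: E1; rewrite /G => ->; rewrite E1' !sc -mulrBr E2 sc2.
  by [].
have [y1 b1 E1] := key u v.
have [y2 b2 E2] := key v u.
rewrite [`|v| + _]addrC in b2.
have gen (A B : R) : h * (h * A) = h * (h * B) -> A = B.
  by move=> /(mulfI (lt0r_neq0 h0)) /(mulfI (lt0r_neq0 h0)).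
have E : 'D_u ('D_v F) y2 = 'D_v ('D_u F) y1.
  have comm : x + h *: v + h *: u = x + h *: u + h *: v by exact: addrAC.
  have swap (a b c k : R) : a - b - (c - k) = a - c - (b - k) by ring.
  apply: gen; apply: (etrans (esym E2)); apply: (etrans _ E1).
  rewrite comm.
  exact: swap.
have := Hu _ _ h1 b2; rewrite E => /dist2_le; apply; exact: Hv h2 b1.
Qed.

Lemma dderivDv (R : realType) (m p : nat) (f : 'cV[R]_m -> R) vs (u v x : 'cV[R]_m) :
  Cp p f -> (size vs < p)%N ->
  dderiv (u + v :: vs) f x = dderiv (u :: vs) f x + dderiv (v :: vs) f x.
Proof.
move=> Cf vsp; have [_ /(_ vsp) dF] := Cf vs (ltnW vsp).
apply: (@deriveDv R _ (dderiv vs f) x u v dF) => w.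
by have [] := Cf (w :: vs) vsp.
Qed.

Lemma dderivZv (R : realType) (m p : nat) (f : 'cV[R]_m -> R) vs (v x : 'cV[R]_m) a :
  Cp p f -> (size vs < p)%N ->
  dderiv (a *: v :: vs) f x = a * dderiv (v :: vs) f x.
Proof.
move=> Cf vsp; have [_ /(_ vsp) dF] := Cf vs (ltnW vsp).
by have [_] := @is_derive_scale _ _ (dderiv vs f) x v a (dF _ _).
Qed.

Lemma dderivC (R : realType) (m p : nat) (f : 'cV[R]_m -> R) vs (u v : 'cV[R]_m) :
  Cp p f -> ((size vs).+1 < p)%N ->
  dderiv (u :: v :: vs) f = dderiv (v :: u :: vs) f.
Proof.
move=> Cf vsp; have vsp' := ltnW vsp; apply/funext => x.
have [_ /(_ vsp') dF] := Cf vs (ltnW vsp').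
apply: (@deriveC R _ (dderiv vs f) x u v dF).
- by move=> y w z; have [_ /(_ vsp) H] := Cf (w :: vs) vsp'; exact: H.
- by have [] := Cf (u :: v :: vs) vsp.
- by have [] := Cf (v :: u :: vs) vsp.
Qed.

(** Adjacent arguments commute, so any argument can be brought to the head of the list, where
    linearity is available. *)
Lemma dderiv_move (R : realType) (m p : nat) (f : 'cV[R]_m -> R) s1 s2 u :
  Cp p f -> ((size (s1 ++ s2)).+1 <= p)%N ->
  dderiv (s1 ++ u :: s2) f = dderiv (u :: s1 ++ s2) f.
Proof.
move=> Cf; elim: s1 => [//|w s1 IH] sp.
have -> : dderiv ((w :: s1) ++ u :: s2) f = dderiv (w :: u :: s1 ++ s2) f.
  by apply/funext => x /=; rewrite IH //; exact: ltnW.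
exact: (dderivC _ _ Cf).
Qed.

(** A separate factor for each argument covers both repeated arguments and normalization to unit
    vectors. The equality is one of functions because the induction differentiates it. *)
Lemma dderiv_scale_map (R : realType) (m p : nat) (f : 'cV[R]_m -> R)
    (a : 'cV[R]_m -> R) (w : 'cV[R]_m -> 'cV[R]_m) vs :
  Cp p f -> (size vs <= p)%N ->
  dderiv [seq a v *: w v | v <- vs] f =
  (fun x => (\prod_(v <- vs) a v) * dderiv [seq w v | v <- vs] f x).
Proof.
move=> Cf; elim: vs => [|v vs IH] sp; apply/funext => x.
  by rewrite big_nil mul1r.
rewrite map_cons (dderivZv _ _ _ Cf) ?size_map// big_cons.
rewrite [in LHS]/= IH; last exact: ltnW.
have sz : (size (map w vs) < p)%N by rewrite size_map.
have [_ /(_ sz) dF] := Cf _ (ltnW sz).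
rewrite -mulrA; congr (_ * _).
exact: (deriveZ _ (dF x (w v))).
Qed.

Lemma dderiv_nseqZ (R : realType) (m p : nat) (f : 'cV[R]_m -> R) i (v x : 'cV[R]_m) a :
  Cp p f -> (i <= p)%N ->
  dderiv (nseq i (a *: v)) f x = a ^+ i * dderiv (nseq i v) f x.
Proof.
move=> Cf ip.
have := dderiv_scale_map (fun=> a) id Cf (_ : size (nseq i v) <= p)%N.
rewrite size_nseq => /(_ ip) /(congr1 (fun g => g x)).
rewrite map_nseq map_id => ->; congr (_ * _).
by rewrite big_const_seq count_predT size_nseq -Monoid.iteropE.
Qed.

(** One argument s + t v splits into s and t v, and both move into the tail; this is why the
    statement carries an arbitrary [tl]. *)
Lemma is_derive_dderiv_nseq (R : realType) (m p : nat) (f : 'cV[R]_m -> R)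
    i tl (s v x : 'cV[R]_m) :
  Cp p f -> (i + size tl <= p)%N ->
  is_derive (0 : R) (1 : R) (fun t : R => dderiv (nseq i (s + t *: v) ++ tl) f x)
    (i%:R * dderiv (nseq i.-1 s ++ v :: tl) f x).
Proof.
move=> Cf; elim: i tl => [|i IH] tl sp.
  by rewrite mul0r; exact: is_derive_cst.
have E : (fun t : R => dderiv (nseq i.+1 (s + t *: v) ++ tl) f x) =
   (fun t : R => dderiv (nseq i (s + t *: v) ++ s :: tl) f x) +
   (id * (fun t : R => dderiv (nseq i (s + t *: v) ++ v :: tl) f x)).
  apply/funext => t.
  have sz' : (size (nseq i (s + t *: v)%R ++ tl) < p)%N.
    by rewrite size_cat size_nseq -addSn.
  rewrite [nseq i.+1 _ ++ tl]/= (dderivDv _ _ _ Cf)//.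
  rewrite (dderivZv _ _ _ Cf)//.
  by rewrite -!(dderiv_move _ Cf).
rewrite E.
have I1 : (i + size (s :: tl) <= p)%N by rewrite /= addnS -addSn.
have dM := is_deriveM (is_derive_id (0 : R) (1 : R)) (IH (v :: tl) I1).
have dD := is_deriveD (IH (s :: tl) I1) dM.
apply: (is_derive_eq dD).
(* At t = 0 the product rule for t times the second term leaves only the value of that term. *)
rewrite scale0r scale0r addr0 add0r /=.
rewrite -[_%:A]/(_ * 1) mulr1 -[i.+1%:R]natr1 mulrDl mul1r; congr (_ + _).
case: i {IH E dM dD} sp I1 => [|i] sp I1; first by rewrite !mul0r.
congr (_ * _); rewrite [i.+1.-1]/=.
have nc : nseq i s ++ s :: tl = nseq i.+1 s ++ tl.
  by elim: (i) => //= j ->.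
have sz : (size (nseq i.+1 s ++ tl) < p)%N by rewrite size_cat size_nseq.
rewrite (dderiv_move v Cf) nc ?[in RHS](dderiv_move v Cf)//.
Qed.

(** The derivative along v of [taylor f p x] at s. By symmetry the term of degree i + 1 gives i + 1
    equal terms, which turns 1/(i+1)! into 1/i!. *)
Definition taylor_grad {R : realType} {m : nat} (f : 'cV[R]_m -> R) (p : nat)
    (x s v : 'cV[R]_m) : R :=
  \sum_(i < p) (i`!%:R)^-1 * dderiv (nseq i s ++ [:: v]) f x.

Lemma is_derive_taylor (R : realType) (m p : nat) (f : 'cV[R]_m -> R)
    (x s v : 'cV[R]_m) :
  Cp p f -> is_derive s v (taylor f p x) (taylor_grad f p x s v).
Proof.
move=> Cf; rewrite -[s]addr0 -(scale0r v); apply/is_derive_lineE.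
have -> : (fun u : R => taylor f p x (s + u *: v)) =
  cst (f x) + \sum_(i < p) ((i.+1)`!%:R)^-1 \*:
      (fun u : R => dderiv (nseq i.+1 (s + u *: v) ++ [::]) f x).
  apply/funext => u; rewrite /taylor big_add1 big_mkord/=.
  congr (_ + _); rewrite fct_sumE; apply: eq_bigr => i _.
  by rewrite -[in LHS](cats0 (nseq _ _)).
have D (i : 'I_p) : is_derive (0 : R) (1 : R)
   ((i.+1)`!%:R^-1 \*:
      (fun u : R => dderiv (nseq i.+1 (s + u *: v) ++ [::]) f x))
   ((i`!%:R)^-1 * dderiv (nseq i s ++ [:: v]) f x).
  have := @is_derive_dderiv_nseq R m p f i.+1 [::] s v x Cf.
  rewrite addn0 => /(_ (ltn_ord i)) dd.
  apply: (is_derive_eq (is_deriveZ _ dd)).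
  rewrite -[_ *: _]/(_ * _) mulrA; congr (_ * _).
  by rewrite factS natrM invfM mulrAC mulVf ?mul1r// pnatr_eq0.
by rewrite scale0r addr0; apply: is_derive_eq; rewrite add0r.
Qed.

(** * Taylor estimates *)

(** [g] is a family of successive derivatives, so the induction on p can be applied to its shift. *)
Lemma taylor_le (R : realType) (p : nat) (g : nat -> R -> R) (C : R) :
  (forall i t, (i < p)%N -> is_derive t (1 : R) (g i) (g i.+1 t)) ->
  (forall t, 0 <= t <= 1 -> g p t <= g p 0 + C * t) ->
  forall t, 0 <= t <= 1 ->
    g 0 t <= \sum_(i < p.+1) (i`!%:R)^-1 * g i 0 * t ^+ i
             + C / (p.+1)`!%:R * t ^+ p.+1.
Proof.
elim: p g => [|p IH] g dg gp t t01.
  rewrite big_ord1 expr1 (_ : 1`! = 1)%N// fact0 invr1 expr0 mul1r !mulr1.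
  exact: gp.
(* [A] is the claimed bound, and its derivative [B] is the claimed bound for the shifted family.
   Hence [g 0 - A] starts from 0 and has a nonpositive derivative on [0, 1]. *)
pose B t := \sum_(i < p.+1) (i`!%:R)^-1 * g i.+1 0 * t ^+ i
             + C / (p.+1)`!%:R * t ^+ p.+1.
pose A : R -> R := (\sum_(i < p.+2) ((i`!%:R)^-1 * g i 0) \*: (fun t : R => t ^+ i))
   + (C / (p.+2)`!%:R) \*: (fun t : R => t ^+ p.+2).
have AE u : A u = \sum_(i < p.+2) (i`!%:R)^-1 * g i 0 * u ^+ i
             + C / (p.+2)`!%:R * u ^+ p.+2.
  by rewrite /A /=; congr (_ + _); rewrite fct_sumE.
have dX (u : R) k : is_derive u (1 : R) (fun t : R => t ^+ k) (k%:R * u ^+ k.-1).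
  have := is_deriveX k (is_derive_id u (1 : R)).
  rewrite (_ : id ^+ k = (fun t : R => t ^+ k)) => [|].
    by move=> H; apply: (is_derive_eq H); rewrite -[_ *: 1]/(_ * 1) mulr1.
  apply/funext => z; elim: k => [|k IHk]; first by rewrite !expr0.
  by rewrite !exprS -IHk.
have dA u : is_derive u (1 : R) A (B u).
  have D (i : 'I_p.+2) : is_derive u (1 : R)
      (((i`!%:R)^-1 * g i 0) \*: (fun t : R => t ^+ i))
      (((i`!%:R)^-1 * g i 0) * (i%:R * u ^+ i.-1)).
    by have := is_deriveZ ((i`!%:R)^-1 * g i 0) (dX u i).
  have D2 := is_deriveZ (C / (p.+2)`!%:R) (dX u p.+2).
  have D1 := is_derive_sum D.
  apply: (is_derive_eq (is_deriveD D1 D2)).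
  have fV n : (n.+1`!%:R)^-1 * n.+1%:R = (n`!%:R)^-1 :> R.
    by rewrite factS natrM invfM mulrAC mulVf ?mul1r// pnatr_eq0.
  rewrite /B; congr (_ + _).
    rewrite big_ord_recl !mul0r mulr0 add0r; apply: eq_bigr => i _.
    by rewrite lift0 mulrACA [X in X * _](fV i) mulrA.
  by rewrite -[LHS]/(C / _ * (_ * _)) mulrA -[X in X * _]mulrA [X in C * X * _](fV p.+1).
have dF u : is_derive u (1 : R) (g 0 - A) (g 1 u - B u).
  exact: is_deriveB (dg 0%N u isT) (dA u).
have neg u : 0 <= u <= 1 -> g 1 u - B u <= 0.
  move=> u01; rewrite subr_le0; apply: (IH (fun i => g i.+1)) => //.
  by move=> i z ip; exact: dg.
have t0 : 0 <= t by case/andP: t01.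
have cF : {within `[0, t], continuous (g 0 - A)}.
  by apply: derivable_within_continuous => u _; have [] := dF u.
have [c cin] := MVT_segment t0 (fun u _ => dF u) cF.
have -> : (g 0 - A) t = g 0 t - A t by [].
have -> : (g 0 - A) 0 = 0.
  rewrite -[LHS]/(g 0 0 - A 0) AE big_ord_recl big1 => [|i _].
    by rewrite fact0 invr1 mul1r expr0 mulr1 addr0 exprS mul0r mulr0 addr0 subrr.
  by rewrite lift0 exprS mul0r mulr0.
rewrite subr0 => E; rewrite -AE -subr_le0 E.
move: cin; rewrite in_itv/= => /andP[c0 ct].
apply: mulr_le0_ge0 => //; last by rewrite subr0.
by apply: neg; rewrite c0 (le_trans ct)//; case/andP: t01.
Qed.

(** * Euclidean norm and operator norm *)

Section Enorm.
Context {R : realType}.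

Lemma enorm_ge0 (m : nat) (v : 'cV[R]_m) : 0 <= enorm v.
Proof. exact: sqrtr_ge0. Qed.

Lemma enorm_sqr (m : nat) (v : 'cV[R]_m) : enorm v ^+ 2 = \sum_i v i 0 ^+ 2.
Proof. by rewrite sqr_sqrtr// sumr_ge0// => i _; rewrite sqr_ge0. Qed.

Lemma enorm0 (m : nat) : enorm (0 : 'cV[R]_m) = 0.
Proof.
by rewrite /enorm big1 ?sqrtr0// => i _; rewrite mxE expr0n.
Qed.

Lemma enorm_eq0 (m : nat) (v : 'cV[R]_m) : enorm v = 0 -> v = 0.
Proof.
move=> v0; have := enorm_sqr v; rewrite v0 expr0n/= => /esym/eqP.
rewrite psumr_eq0 => [/allP H|i _]; last exact: sqr_ge0.
apply/matrixP => i j; rewrite ord1 mxE.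
by have := H i (mem_index_enum _); rewrite sqrf_eq0 => /eqP.
Qed.

Lemma enormZ (m : nat) (a : R) (v : 'cV[R]_m) : enorm (a *: v) = `|a| * enorm v.
Proof.
rewrite /enorm -sqrtr_sqr -sqrtrM ?sqr_ge0// mulr_sumr; congr Num.sqrt.
by apply: eq_bigr => i _; rewrite mxE exprMn.
Qed.

(** Cauchy-Schwarz: the sum of the squares of |v| u_i - |u| v_i is nonnegative and equals 2 |u| |v|
    (|u| |v| - u.v). *)
Lemma dot_le_enorm (m : nat) (u v : 'cV[R]_m) :
  \sum_i u i 0 * v i 0 <= enorm u * enorm v.
Proof.
have [/eqP u0|u0] := eqVneq (enorm u) 0.
  by rewrite (enorm_eq0 (eqP u0)) enorm0 mul0r big1// => i _; rewrite mxE mul0r.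
have [/eqP v0|v0] := eqVneq (enorm v) 0.
  by rewrite (enorm_eq0 (eqP v0)) enorm0 mulr0 big1// => i _; rewrite mxE mulr0.
pose a := enorm u; pose b := enorm v.
have a0 : 0 < a by rewrite lt_def u0 enorm_ge0.
have b0 : 0 < b by rewrite lt_def v0 enorm_ge0.
have : 0 <= \sum_i (b * u i 0 - a * v i 0) ^+ 2.
  by rewrite sumr_ge0// => i _; rewrite sqr_ge0.
rewrite (eq_bigr (fun i => b ^+ 2 * u i 0 ^+ 2 + a ^+ 2 * v i 0 ^+ 2
   - (2 * a * b) * (u i 0 * v i 0))) => [|i _]; last by ring.
rewrite sumrB big_split/= -!mulr_sumr -!enorm_sqr -/a -/b.
move: (\sum_i _) => S; rewrite (_ : _ - _ = (2 * (a * b)) * (a * b - S)); last by ring.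
by rewrite pmulr_rge0 ?subr_ge0// !mulr_gt0.
Qed.

Lemma enormD (m : nat) (u v : 'cV[R]_m) : enorm (u + v) <= enorm u + enorm v.
Proof.
rewrite -[leRHS]ger0_norm ?addr_ge0 ?enorm_ge0//.
rewrite -[leLHS]ger0_norm ?enorm_ge0// -ler_sqr// !real_normK ?num_real//.
rewrite enorm_sqr (eq_bigr (fun i => u i 0 ^+ 2 + v i 0 ^+ 2
   + 2 * (u i 0 * v i 0))) => [|i _]; last by rewrite mxE; ring.
rewrite big_split big_split/= -mulr_sumr -!enorm_sqr sqrrD -mulr_natl.
by have := dot_le_enorm u v; lra.
Qed.

Lemma opnorm_bound_ge0 (a b : nat) (A : 'M[R]_(a, b)) (k : R) :
  (opnorm A <= k%:E)%E -> 0 <= k.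
Proof.
move=> Ak; rewrite -lee_fin; apply: le_trans Ak; apply: ereal_sup_ubound.
by exists 0; rewrite /= ?mulmx0 enorm0.
Qed.

Lemma opnorm_mulmx (a b : nat) (A : 'M[R]_(a, b)) (k : R) (v : 'cV[R]_b) :
  (opnorm A <= k%:E)%E -> enorm (A *m v) <= k * enorm v.
Proof.
move=> Ak; have [/eqP v0|v0] := eqVneq (enorm v) 0.
  by rewrite (eqP v0) (enorm_eq0 (eqP v0)) mulmx0 enorm0 mulr0.
have p0 : 0 < enorm v by rewrite lt_def v0 enorm_ge0.
rewrite -ler_pdivrMr// mulrC.
have -> : (enorm v)^-1 * enorm (A *m v) = enorm (A *m ((enorm v)^-1 *: v)).
  by rewrite -scalemxAr enormZ ger0_norm// invr_ge0 ltW.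
rewrite -lee_fin; apply: le_trans Ak; apply: ereal_sup_ubound.
exists ((enorm v)^-1 *: v) => //=.
by rewrite enormZ normfV [`|enorm v|]ger0_norm ?enorm_ge0// mulVf//.
Qed.

Lemma additive_homogeneous_dot (m : nat) (L : 'cV[R]_m -> R) :
  (forall u v, L (u + v) = L u + L v) -> (forall a v, L (a *: v) = a * L v) ->
  forall v, L v = \sum_i v i 0 * L (delta_mx i 0).
Proof.
move=> LD LZ v.
have L0 : L 0 = 0 by rewrite -(scale0r 0) LZ mul0r.
rewrite [in LHS](matrix_sum_delta v) (big_morph L LD L0).
by apply: eq_bigr => i _; rewrite big_ord1 LZ.
Qed.

End Enorm.

(** [tnorm] controls arguments in the unit ball; multilinearity extends the bound to all
    arguments. *)
Lemma AS3_bound (R : realType) (m p : nat) (f : 'cV[R]_m -> R) (Lp : R) vs x y :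
  Cp p f -> AS3 p f Lp -> size vs = p ->
  `|dderiv vs f x - dderiv vs f y| <= Lp * enorm (x - y) * \prod_(v <- vs) enorm v.
Proof.
move=> Cf /(_ x y) fL sp.
(* The inverse of 0 is 0, so a zero argument is normalized to 0 and is still recovered from its norm
   and [w v]. *)
pose w (v : 'cV[R]_m) := (enorm v)^-1 *: v.
have E : [seq enorm v *: w v | v <- vs] = vs.
  rewrite -[RHS]map_id; apply: eq_map => v; rewrite /w scalerA.
  have [v0|v0] := eqVneq (enorm v) 0; last by rewrite mulfV// scale1r.
  by rewrite (enorm_eq0 v0) scaler0.
have szp : (size vs <= p)%N by rewrite sp.
have D z : dderiv vs f z = \prod_(v <- vs) enorm v * dderiv (map w vs) f z.
  by rewrite -[in LHS]E (dderiv_scale_map _ _ Cf).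
rewrite !D -mulrBr normrM ger0_norm; last first.
  by apply: prodr_ge0 => v _; exact: enorm_ge0.
rewrite mulrC ler_wpM2r//; first by apply: prodr_ge0 => v _; exact: enorm_ge0.
rewrite -lee_fin; apply: le_trans fL; apply: ereal_sup_ubound.
exists (map w vs) => //; split; first by rewrite size_map.
apply/allP => u /mapP[v _ ->]; rewrite /w enormZ ger0_norm ?invr_ge0 ?enorm_ge0//.
have [v0|v0] := eqVneq (enorm v) 0; last by rewrite mulVf.
by rewrite v0 mulr0.
Qed.

Lemma prod_nseq (R : comRingType) (T : Type) (F : T -> R) k x :
  \prod_(v <- nseq k x) F v = F x ^+ k.
Proof. by elim: k => [|k IH]; rewrite ?big_nil//= big_cons IH exprS. Qed.

(** * Errors of the Taylor model and of its sketched gradient *)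

Section TaylorBounds.
Context {R : realType} {m p : nat} (f : 'cV[R]_m -> R) (Lp : R).
Hypotheses (Cf : Cp p f) (fL : AS3 p f Lp).

(** This is [taylor_le] on the segment from x to x + s, where the p-th derivative along s varies by
    at most Lp |s|^(p+1) t. *)
Lemma taylor_upper_bound (x s : 'cV[R]_m) :
  f (x + s) <= taylor f p x s + Lp / (p.+1)`!%:R * enorm s ^+ p.+1.
Proof.
pose g i (t : R) := dderiv (nseq i s) f (x + t *: s).
have dg i t : (i < p)%N -> is_derive t (1 : R) (g i) (g i.+1 t).
  move=> ip; apply/is_derive_lineE; apply: derivableP.
  have sz : (size (nseq i s) < p)%N by rewrite size_nseq.
  by have [_ /(_ sz)] := Cf (ltnW sz); exact.
have gp t : 0 <= t <= 1 -> g p t <= g p 0 + Lp * enorm s ^+ p.+1 * t.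
  move=> /andP[t0 _]; rewrite -lerBlDl.
  have := AS3_bound (x + t *: s) (x + 0 *: s) Cf fL (size_nseq p s).
  move=> /(le_trans (ler_norm _)) /le_trans; apply.
  rewrite scale0r addr0 addrCK enormZ ger0_norm// prod_nseq exprS.
  by rewrite (_ : _ * _ = Lp * (enorm s * enorm s ^+ p) * t)//; ring.
have := taylor_le dg gp (t := 1); rewrite ler01 lexx => /(_ isT).
rewrite /g scale1r /= => /le_trans; apply.
rewrite expr1n mulr1 mulrAC lerD2r /taylor big_ord_recl.
rewrite scale0r addr0 fact0 invr1 mul1r expr0 mulr1 lerD2l.
rewrite big_add1 big_mkord le_eqVlt; apply/orP; left; apply/eqP.
by apply: eq_bigr => i _; rewrite expr1n mulr1 lift0.
Qed.

(** The same argument one order lower, for the derivative along v; the constant is Lp |s|^p |v|. *)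
Lemma taylor_grad_bound (x s v : 'cV[R]_m) : (0 < p)%N ->
  dderiv [:: v] f (x + s) - taylor_grad f p x s v
  <= Lp / p`!%:R * enorm s ^+ p * enorm v.
Proof.
move=> p0; rewrite lerBlDl.
pose q := p.-1; have qp : p = q.+1 by rewrite prednK.
pose g i (t : R) := dderiv (nseq i s ++ [:: v]) f (x + t *: s).
have sz i : (size (nseq i s ++ [:: v]) = i.+1)%N by rewrite size_cat size_nseq addn1.
have dg i t : (i < q)%N -> is_derive t (1 : R) (g i) (g i.+1 t).
  move=> ip; apply/is_derive_lineE; apply: derivableP.
  have szi : (size (nseq i s ++ [:: v]) < p)%N by rewrite sz qp.
  by have [_ /(_ szi)] := Cf (ltnW szi); exact.
have gp t : 0 <= t <= 1 -> g q t <= g q 0 + Lp * enorm s ^+ p * enorm v * t.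
  move=> /andP[t0 _]; rewrite -lerBlDl.
  have szq : (size (nseq q s ++ [:: v]) = p)%N by rewrite sz qp.
  have := AS3_bound (x + t *: s) (x + 0 *: s) Cf fL szq.
  move=> /(le_trans (ler_norm _)) /le_trans; apply.
  rewrite scale0r addr0 addrCK enormZ ger0_norm// big_cat prod_nseq big_seq1 /=.
  rewrite qp exprS.
  by rewrite (_ : _ * _ = Lp * (enorm s * enorm s ^+ q) * enorm v * t)//; ring.
have := taylor_le dg gp (t := 1); rewrite ler01 lexx => /(_ isT).
rewrite -qp /g scale1r /= => /le_trans; apply.
rewrite expr1n mulr1 lerD//; last by rewrite mulrAC [X in X * _]mulrAC.
rewrite scale0r addr0 le_eqVlt; apply/orP; left; apply/eqP.
by apply: eq_bigr => i _; rewrite expr1n mulr1.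
Qed.

Lemma dderiv_dot (x v : 'cV[R]_m) : (0 < p)%N ->
  dderiv [:: v] f x = \sum_i v i 0 * (grad f x) i 0.
Proof.
move=> p0; rewrite (additive_homogeneous_dot (L := fun v => dderiv [:: v] f x)).
- by apply: eq_bigr => i _; rewrite mxE.
- by move=> u w; exact: dderivDv Cf _.
- by move=> a w; exact: dderivZv Cf _.
Qed.

Lemma taylor_gradE (x s v : 'cV[R]_m) : (0 < p)%N ->
  taylor_grad f p x s v = \sum_i v i 0 * taylor_grad f p x s (delta_mx i 0).
Proof.
move=> p0; pose L i v := dderiv (nseq i s ++ [:: v]) f x.
have LE (i : 'I_p) w : L i w = dderiv (w :: nseq i s) f x.
  by rewrite /L (dderiv_move _ Cf) cats0// size_nseq.
apply: additive_homogeneous_dot => [u w|a w].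
  rewrite /taylor_grad -big_split; apply: eq_bigr => i _ /=.
  rewrite -mulrDr -![dderiv _ _ _]/(L _ _) !LE; congr (_ * _).
  by apply: (dderivDv _ _ _ Cf); rewrite size_nseq.
rewrite /taylor_grad mulr_sumr; apply: eq_bigr => i _ /=.
rewrite mulrCA -![dderiv _ _ _]/(L _ _) !LE; congr (_ * _).
by apply: (dderivZv _ _ _ Cf); rewrite size_nseq.
Qed.

(** Chain rule for the linear map S^T: moving along the j-th basis vector in the sketched space is
    moving along its image under S^T. *)
Lemma grad_That (l : nat) (x : 'cV[R]_m) (S : 'M[R]_(l, m)) (sh : 'cV[R]_l) j :
  grad (That f p x S) sh j 0 =
  taylor_grad f p x (S^T *m sh) (S^T *m delta_mx j 0).
Proof.
rewrite mxE /= /derive.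
have -> : (fun h : R => h^-1 *: ((That f p x S \o shift sh) (h *: delta_mx j 0)
      - That f p x S sh)) =
   (fun h : R => h^-1 *: ((taylor f p x \o shift (S^T *m sh))
       (h *: (S^T *m delta_mx j 0)) - taylor f p x (S^T *m sh))).
  by apply/funext => h; rewrite /That /= mulmxDr scalemxAr.
by have [_] := is_derive_taylor x (S^T *m sh) (S^T *m delta_mx j 0) Cf.
Qed.

(** The sketched gradients differ by [S *m e], where e is the gradient error of the full model, so a
    bound on |e| and one on the norm of S suffice. *)
Lemma sketched_gradient_error (l : nat) (x : 'cV[R]_m) (S : 'M[R]_(l, m))
    (sh : 'cV[R]_l) (kS : R) : (0 < p)%N -> 0 <= Lp ->
  (opnorm S <= kS%:E)%E ->
  enorm (S *m grad f (x + S^T *m sh)) - enorm (grad (That f p x S) sh)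
  <= kS * (Lp / p`!%:R * enorm (S^T *m sh) ^+ p).
Proof.
move=> p0 Lp0 SkS; set s := S^T *m sh.
pose e : 'cV[R]_m := \col_i (grad f (x + s) i 0 - taylor_grad f p x s (delta_mx i 0)).
have eE (v : 'cV[R]_m) : \sum_i v i 0 * e i 0 = dderiv [:: v] f (x + s) - taylor_grad f p x s v.
  rewrite dderiv_dot// taylor_gradE// -sumrB; apply: eq_bigr => i _.
  by rewrite !mxE mulrBr.
have ee : enorm e <= Lp / p`!%:R * enorm s ^+ p.
  have [e0|e0] := eqVneq (enorm e) 0.
    by rewrite e0 mulr_ge0// ?divr_ge0// exprn_ge0// enorm_ge0.
  have epos : 0 < enorm e by rewrite lt_def e0 enorm_ge0.
  (* Taking the direction v = e in the directional bound gives |e|^2 on the left and a factor |e| on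
     the right. *)
  rewrite -(ler_pM2r epos); apply: le_trans (taylor_grad_bound x s e p0).
  rewrite -eE -expr2 enorm_sqr le_eqVlt; apply/orP; left; apply/eqP.
  by apply: eq_bigr => i _; rewrite expr2.
have SE : S *m grad f (x + s) = grad (That f p x S) sh + S *m e.
  apply/matrixP => j k; rewrite ord1 [RHS]mxE grad_That -/s taylor_gradE//.
  rewrite mxE [X in _ = _ + X]mxE -big_split; apply: eq_bigr => i _ /=.
  have -> : (S^T *m (delta_mx j 0 : 'cV[R]_l)) i 0 = S j i.
    by rewrite -colE !mxE.
  by rewrite [e i 0]mxE -mulrDr [in RHS]addrC subrK.
rewrite SE lerBlDl (le_trans (enormD _ _))// lerD2l.
apply: (le_trans (opnorm_mulmx e SkS)).
by rewrite ler_wpM2l// (opnorm_bound_ge0 SkS).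
Qed.

End TaylorBounds.

(** * Realizations of the algorithm *)

Lemma powR_invn_exprn (R : realType) (c : R) (k : nat) :
  0 <= c -> (0 < k)%N -> (c `^ (k%:R)^-1) ^+ k = c.
Proof.
by move=> c0 k0; rewrite -powR_mulrn ?powR_ge0// -powRrM mulVf ?powRr1// pnatr_eq0 -lt0n.
Qed.

(** If r exceeded the bound, each root a_i of c_i would be at most r, so c_i r^i = a_i^(p-i+1) r^i
    <= a_i r^p, and likewise for b. Summing would bound r by the sum of the roots, half of what it
    was assumed to exceed. *)
Lemma step_size_bound (R : realType) (p : nat) (b r : R) (c : nat -> R) :
  (0 < p)%N -> 0 <= b -> (forall i, 0 <= c i) -> 0 <= r ->
  r ^+ p.+1 <= b * r + \sum_(2 <= i < p.+1) c i * r ^+ i ->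
  r <= 2 * \sum_(2 <= i < p.+1) (c i) `^ ((p - i).+1%:R)^-1
       + 2 * b `^ (p%:R)^-1.
Proof.
move=> p0 b0 c0 r0 rp; rewrite leNgt; apply/negP => rbig.
pose a i := (c i) `^ ((p - i).+1%:R)^-1.
pose a1 := b `^ (p%:R)^-1.
pose W := \sum_(2 <= i < p.+1) a i.
rewrite -/a1 -/W in rbig.
have a0 i : 0 <= a i by exact: powR_ge0.
have a10 : 0 <= a1 by exact: powR_ge0.
have W0 : 0 <= W by rewrite sumr_ge0.
have rgt0 : 0 < r by apply: le_lt_trans rbig; rewrite addr_ge0// mulr_ge0.
have pw y k : (0 < k)%N -> 0 <= y -> y <= r -> y ^+ k <= y * r ^+ k.-1.
  by case: k => // k _ y0 yr; rewrite exprS ler_wpM2l// lerXn2r// nnegrE.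
have B1 : b * r <= a1 * r ^+ p.
  rewrite -{1}(powR_invn_exprn b0 p0) -/a1.
  have a1r : a1 <= r by lra.
  have := pw _ _ p0 a10 a1r; move=> /(ler_wpM2r r0) /le_trans; apply.
  by rewrite -mulrA -exprSr prednK.
have B2 : \sum_(2 <= i < p.+1) c i * r ^+ i <= W * r ^+ p.
  rewrite /W mulr_suml big_nat_cond [leRHS]big_nat_cond; apply: ler_sum.
  move=> i /andP[/andP[i2 ip] _].
  rewrite -{1}(powR_invn_exprn (c0 i) (ltn0Sn (p - i))) -/(a i).
  have aiW : a i <= W.
    rewrite /W (bigD1_seq i) ?iota_uniq ?mem_index_iota ?i2//=.
    by rewrite lerDl sumr_ge0.
  have air : a i <= r by lra.
  have := pw _ _ (ltn0Sn (p - i)) (a0 i) air.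
  move=> /(ler_wpM2r (exprn_ge0 i r0)) /le_trans; apply.
  by rewrite -mulrA -exprD subnK.
have : r * r ^+ p <= (a1 + W) * r ^+ p.
  by rewrite -exprS (le_trans rp)// mulrDl lerD.
rewrite ler_pM2r ?exprn_gt0//; lra.
Qed.

Lemma powR_le_exprS (R : realType) (p : nat) (r y : R) :
  (0 < p)%N -> 0 <= r -> 0 <= y -> y <= r ^+ p -> y `^ (p.+1%:R / p%:R) <= r ^+ p.+1.
Proof.
move=> p0 r0 y0 yr.
have pn0 : p%:R != 0 :> R by rewrite pnatr_eq0 -lt0n.
have -> : r ^+ p.+1 = (r ^+ p) `^ (p.+1%:R / p%:R).
  by rewrite -powR_mulrn// -[in RHS]powR_mulrn// -powRrM mulrCA mulfV// mulr1.
by rewrite ge0_ler_powR// ?nnegrE ?exprn_ge0// divr_ge0.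
Qed.

(** * Lower bounds on the Taylor model *)

Section DerivativeLowerBounds.
Context {R : realType} {m p : nat} (f : 'cV[R]_m -> R) (kg khigh : R).
Hypotheses (Cf : Cp p f) (fkg : AS4 f kg) (fkh : AS5 p f khigh).

Lemma dderiv_nseq_ge (x s : 'cV[R]_m) i : (2 <= i <= p)%N ->
  - khigh * enorm s ^+ i <= dderiv (nseq i s) f x.
Proof.
move=> ip; have [i2 ip'] := andP ip.
have Es : s = enorm s *: ((enorm s)^-1 *: s).
  have [s0|s0] := eqVneq (enorm s) 0; last by rewrite scalerA mulfV// scale1r.
  by rewrite s0 scale0r (enorm_eq0 s0).
rewrite [in leRHS]Es (dderiv_nseqZ _ _ _ Cf)// mulrC ler_wpM2l ?exprn_ge0 ?enorm_ge0//.
apply: fkh => //; rewrite enormZ normfV [`|enorm s|]ger0_norm ?enorm_ge0//.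
by have [s0|s0] := eqVneq (enorm s) 0; [rewrite s0 mulr0|rewrite mulVf].
Qed.

Lemma dderiv1_ge (x s : 'cV[R]_m) : (0 < p)%N ->
  - kg * enorm s <= dderiv [:: s] f x.
Proof.
move=> p0; rewrite mulNr lerNl (dderiv_dot Cf)//.
have -> : - (\sum_i s i 0 * grad f x i 0) = \sum_i ((-1) *: s) i 0 * grad f x i 0.
  by rewrite -sumrN; apply: eq_bigr => i _; rewrite [(_ *: s) i 0]mxE mulN1r mulNr.
apply: (le_trans (dot_le_enorm _ _)).
by rewrite enormZ normrN1 mul1r mulrC ler_wpM2r ?enorm_ge0.
Qed.

Lemma taylor_ge (x s : 'cV[R]_m) : (0 < p)%N ->
  f x - kg * enorm s - \sum_(2 <= i < p.+1) (i`!%:R)^-1 * (khigh * enorm s ^+ i)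
  <= taylor f p x s.
Proof.
move=> p0; rewrite /taylor -addrA lerD2l -opprD lerNl.
rewrite big_ltn// opprD -sumrN; apply: lerD.
  rewrite invr1 mul1r -lerN2 opprK; have := dderiv1_ge x s p0.
  by rewrite mulNr => /le_trans; apply.
rewrite big_nat_cond [leRHS]big_nat_cond; apply: ler_sum => i /andP[i2 _].
rewrite -mulrN ler_wpM2l ?invr_ge0// lerNl -mulNr.
by apply: dderiv_nseq_ge; move: i2; rewrite ltnS.
Qed.

End DerivativeLowerBounds.

(** * Bounds on steps, function values, [nu] and [sigma] along one realization *)

Section Run.
Context {R : realType} {n l p : nat}.
Variables (f : 'cV[R]_n -> R) (x0 : 'cV[R]_n).
Variables (nu0 theta mum1 vartheta Lp flow kg khigh : R).
Variables (x : nat -> 'cV[R]_n) (S : nat -> 'M[R]_(l, n)).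
Variables (sh : nat -> 'cV[R]_l) (sigma nu mu kS : nat -> R).
Hypotheses (p0 : (1 <= p)%N) (nu0_gt0 : 0 < nu0) (vt01 : 0 < vartheta < 1).
Hypotheses (Lp0 : 0 <= Lp) (kg0 : 0 <= kg) (kh0 : 0 <= khigh).
Hypotheses (Cf : Cp p f) (flow_le : AS2 f flow) (fL : AS3 p f Lp).
Hypotheses (fkg : AS4 f kg) (fkh : AS5 p f khigh).
Hypothesis run : skoffar_run f p x0 nu0 theta mum1 vartheta x S sh sigma nu mu kS.

Let s k := (S k)^T *m sh k.
Let r k := enorm (s k).
Let u k := r k ^+ p.+1.
Let D : R := (p.+1)`!%:R.
Let numax := nu_max p Lp kg khigh vartheta nu0.
Let fmax := f_max (f x0) p Lp kg khigh vartheta nu0.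

Let D_gt0 : 0 < D. Proof. by rewrite ltr0n fact_gt0. Qed.
Let vt0 : 0 < vartheta. Proof. by case/andP: vt01. Qed.
Let r0 k : 0 <= r k. Proof. exact: enorm_ge0. Qed.
Let u0 k : 0 <= u k. Proof. by rewrite exprn_ge0. Qed.

Let nuS k : nu k.+1 = nu k + nu k * u k.
Proof. by case: run => _ _ _ _ /(_ k) [_ _ _ _ [_ _ ->]]. Qed.

Let xS k : x k.+1 = x k + s k.
Proof. by case: run => _ _ _ _ /(_ k) [_ _ _ _ [_ -> _]]. Qed.

Let nu_ge k : nu0 <= nu k.
Proof.
elim: k => [|k IH]; first by case: run => _ ->.
rewrite nuS (le_trans IH)// lerDl mulr_ge0//.
exact: le_trans (ltW nu0_gt0) IH.
Qed.

Let nu_pos k : 0 <= nu k. Proof. exact: le_trans (ltW nu0_gt0) (nu_ge k). Qed.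

Lemma sigma_ge_nu k : vartheta * nu k <= sigma k.
Proof.
case: run => _ nu00 sig0 _ H; case: k => [|k]; last by case: (H k) => _ _ /andP[].
by rewrite nu00 sig0 ger_pMl//; case/andP: vt01 => _ /ltW.
Qed.

Lemma sigma_ge k : vartheta * nu0 <= sigma k.
Proof. by apply: le_trans (sigma_ge_nu k); rewrite ler_pM2l. Qed.

(** Derivatives along the zero direction vanish, so the model at 0 has the value f(x_k). *)
Let model_decrease k : taylor f p (x k) (s k) + sigma k / D * u k < f (x k).
Proof.
case: run => _ _ _ _ /(_ k) [_ _ _ + _].
rewrite /mhat /That mulmx0 enorm0 expr0n mulr0 addr0 => /lt_le_trans; apply.
rewrite /taylor big_nat_cond big1 ?addr0// => -[//|i] _.
by rewrite /= derive0 /cst /= mulr0.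
Qed.

(** The regularization term is at most the possible decrease of the Taylor model, which [taylor_ge]
    bounds by lower powers of r. With sigma >= vartheta nu0 this is the inequality of
    [step_size_bound]. *)
Lemma step_le k : r k <= 2 * eta_c p khigh vartheta nu0
        + 2 * ((D * kg) / (vartheta * nu0)) `^ (p%:R)^-1.
Proof.
have vn0 : 0 < vartheta * nu0 by rewrite mulr_gt0.
apply: step_size_bound => //.
- by rewrite divr_ge0 ?mulr_ge0// ltW.
- by move=> i; rewrite divr_ge0 ?mulr_ge0// ltW.
have := model_decrease k.
have := taylor_ge Cf fkg fkh (x k) (s k) p0.
rewrite -/(r k); set E := \sum_(_ <= _ < _) _; set T := taylor _ _ _ _ => T1 T2.
have T3 : sigma k / D * u k <= kg * r k + E by lra.
have T4 : vartheta * nu0 / D * u k <= kg * r k + E.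
  apply: le_trans T3; rewrite ler_wpM2r// ler_pM2r ?invr_gt0//.
  exact: sigma_ge.
rewrite -/(u k).
have -> : D * kg / (vartheta * nu0) * r k + \sum_(2 <= i < p.+1)
   khigh * (p.+1)`!%:R / (i`!%:R * vartheta * nu0) * r k ^+ i =
   (vartheta * nu0 / D)^-1 * (kg * r k + E).
  rewrite invf_div mulrDr /E mulr_sumr; congr (_ + _); first by ring.
  apply: eq_bigr => i _; rewrite -/D.
  rewrite -(mulrA i`!%:R) [(i`!%:R * _)^-1]invfM; ring.
by rewrite ler_pdivlMl// divr_gt0.
Qed.

Let f_step k : f (x k.+1) <= f (x k) + (Lp - sigma k) / D * u k.
Proof.
rewrite xS; have := taylor_upper_bound Cf fL (x k) (s k).
have := model_decrease k; rewrite -/(r k) -/(u k) -/D mulrBl mulrBl.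
lra.
Qed.

Lemma mu_le k : mu k <= Num.max mum1 Lp.
Proof.
case: run => _ _ _ mu0 H; elim: k => [|k IH]; first by rewrite mu0 le_max lexx.
have [Sk -> _ _ _] := H k; rewrite ge_max IH/= le_max; apply/orP; right.
rewrite xS; have := sketched_gradient_error Cf fL (x k) (sh k) p0 Lp0 Sk; rewrite -/(s k) -/(r k).
set num := _ - _ => Hnum.
have LpD : Lp / p`!%:R <= Lp.
  by rewrite ler_pdivrMr ?ltr0n ?fact_gt0// ler_peMr// ler1n fact_gt0.
(* With a zero denominator the quotient is 0 by convention, hence at most Lp. *)
have [E|E] := eqVneq (kS k * r k ^+ p) 0; first by rewrite E invr0 mulr0.
have Epos : 0 < kS k * r k ^+ p.
  by rewrite lt_def E mulr_ge0// ?exprn_ge0// (opnorm_bound_ge0 Sk).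
rewrite ler_pdivrMr// (le_trans Hnum)//.
by rewrite mulrCA ler_wpM2r// ltW.
Qed.

(** [nu_max] is the threshold 2 Lp / vartheta times a bound on the growth factor of nu in one
    step. *)
Let u_le k : 2 * Lp / vartheta * (1 + u k) <= numax.
Proof.
have LV : 0 <= 2 * Lp / vartheta by rewrite divr_ge0 ?mulr_ge0// ltW.
rewrite /numax /nu_max ler_wpM2l// lerD2l.
have rk := step_le k.
by apply: lerXn2r rk; rewrite nnegrE// (le_trans (r0 k) (step_le k)).
Qed.

(** A step raises f by at most Lp u_k / (p+1)! and raises nu by nu_k u_k >= nu0 u_k, so any increase
    of f is paid for by growth of nu. *)
Let f_le_nu k : f (x k) <= f x0 + Lp / (D * nu0) * (nu k - nu0).
Proof.
elim: k => [|k IH].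
  by case: run => -> -> _ _ _; rewrite subrr mulr0 addr0.
rewrite nuS (le_trans (f_step k))//.
have sg : 0 <= sigma k by apply: le_trans (sigma_ge k); rewrite mulr_ge0// ltW.
have h1 : (Lp - sigma k) / D * u k <= Lp / D * u k.
  rewrite ler_wpM2r// ler_pM2r ?invr_gt0//; lra.
have h2 : Lp / D * u k <= Lp / (D * nu0) * (nu k * u k).
  rewrite invfM !mulrA -(mulrA (Lp / D)) -(mulrA (Lp / D)) ler_wpM2l//.
    by rewrite divr_ge0// ltW.
  by rewrite ler_peMl// ler_pdivlMl// mulr1.
rewrite (_ : nu k + nu k * u k - nu0 = (nu k - nu0) + nu k * u k); last by ring.
rewrite mulrDr; lra.
Qed.

(** From this threshold on, sigma >= vartheta nu >= 2 Lp, which makes every step decrease f. *)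
Let large k := 2 * Lp / vartheta <= nu k.

Let nu_mono i k : (i <= k)%N -> nu i <= nu k.
Proof.
move=> /subnK <-; elim: (k - i)%N => // j; rewrite addSn nuS => /le_trans; apply.
by rewrite lerDl mulr_ge0.
Qed.

(** Once sigma >= 2 Lp, Lp - sigma <= - sigma / 2 <= - vartheta nu / 2. The decrease of f is then at
    least a fixed multiple of the increment nu u of nu, and the sum telescopes. *)
Let f_after i k : (i <= k)%N -> large i ->
  f (x k) + vartheta / (2 * D) * (nu k - nu i) <= f (x i).
Proof.
move=> /subnK <-; elim: (k - i)%N => [|j IH] li.
  by rewrite subrr mulr0 addr0.
set m := (j + i)%N; rewrite addSn -/m in IH *; move: IH => /(_ li) IH.
have lm : large m by apply: le_trans li _; exact: nu_mono (leq_addl _ _).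
rewrite nuS; have := f_step m.
have sg : 2 * Lp <= sigma m.
  apply: le_trans (sigma_ge_nu m); have := lm; rewrite /large ler_pdivrMr//.
  by rewrite [nu m * _]mulrC.
have sn := sigma_ge_nu m.
have h1 : (Lp - sigma m) / D * u m <= - (vartheta / (2 * D) * (nu m * u m)).
  have -> : - (vartheta / (2 * D) * (nu m * u m)) =
      (- (vartheta * nu m) / 2) / D * u m by rewrite invfM; ring.
  by rewrite ler_wpM2r// ler_pM2r ?invr_gt0//; lra.
rewrite (_ : nu m + nu m * u m - nu i = (nu m - nu i) + nu m * u m); last by ring.
rewrite [_ * (_ - _ + _)]mulrDr; lra.
Qed.

Let numax_ge0 : 0 <= numax.
Proof.
apply: le_trans (u_le 0); rewrite mulr_ge0 ?divr_ge0 ?addr_ge0 ?mulr_ge0//.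
exact: ltW.
Qed.

Let fmaxE : fmax = f x0 + Lp / (D * nu0) * numax + vartheta * nu0 / D.
Proof. by rewrite /fmax /f_max -/D -/numax invfM; ring. Qed.

(* At the first index where nu becomes large, nu has been multiplied by at
   most 1 + u from below the threshold. *)
Let first_large i : large i -> (forall j, (j < i)%N -> ~~ large j) ->
  nu i <= nu0 + numax /\ f (x i) <= fmax - vartheta * nu0 / D.
Proof.
case: i => [|i] li small.
  case: run => -> -> _ _ _; split; first by rewrite lerDl.
  by rewrite fmaxE addrK lerDl mulr_ge0// divr_ge0// mulr_ge0// ltW.
have nuS_le : nu i.+1 <= numax.
  apply: le_trans (u_le i); rewrite nuS -[X in X + _]mulr1 -mulrDr.
  rewrite ler_wpM2r ?addr_ge0// ltW// ltNge; exact: small.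
split; first by rewrite (le_trans nuS_le)// lerDr ltW.
apply: (le_trans (f_le_nu _)); rewrite fmaxE addrK lerD2l ler_wpM2l//.
  by rewrite divr_ge0// mulr_ge0// ltW.
by rewrite lerBlDr (le_trans nuS_le)// lerDl ltW.
Qed.

Let large_case k : large k -> exists i, [/\ (i <= k)%N, large i &
  forall j, (j < i)%N -> ~~ large j].
Proof.
move=> lk; have ex : exists k, large k by exists k.
exists (ex_minn ex); case: ex_minnP => i li imin; split => //.
  exact: imin.
by move=> j ji; apply/negP => /imin; rewrite leqNgt ji.
Qed.

(** The last term of [f_max] is a deliberate slack; it makes the gap positive and later absorbs
    additive constants. *)
Lemma fmax_gap : vartheta * nu0 / D <= fmax - flow.
Proof.
rewrite fmaxE; have := flow_le x0.
have : 0 <= Lp / (D * nu0) * numax.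
  by rewrite mulr_ge0// divr_ge0// mulr_ge0// ltW.
lra.
Qed.

(** Past the first large index, growth of nu costs a proportional decrease of f, and f cannot fall
    below [flow]. *)
Lemma nu_le k : nu k <= Num.max (2 * D / vartheta * (fmax - flow) + numax)
   (2 * Lp / vartheta).
Proof.
have [lk|/negP] := boolP (large k); last first.
  by move=> lk; rewrite le_max [X in _ || X]ltW ?orbT// ltNge; apply/negP.
have [i [ik li small]] := large_case lk.
have [nui fi] := first_large li small.
have := f_after ik li; have := flow_le (x k) => h1 h2.
have h3 : vartheta / (2 * D) * (nu k - nu i) <= fmax - vartheta * nu0 / D - flow by lra.
have c0 : 0 < vartheta / (2 * D) by rewrite divr_gt0// mulr_gt0.
rewrite le_max; apply/orP; left.
move: h3; rewrite -ler_pdivlMl// invf_div.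
(* The slack in [f_max] becomes - 2 nu0, which absorbs the nu0 in the bound on [nu i]. *)
have -> : 2 * D / vartheta * (fmax - vartheta * nu0 / D - flow) =
   2 * D / vartheta * (fmax - flow) - 2 * nu0.
  by field; rewrite !gt_eqF.
by move: nui nu0_gt0; lra.
Qed.

Lemma sigma_le k :
  sigma k <= sigma_max (f x0) flow p Lp kg khigh vartheta nu0 mum1.
Proof.
have LV : Lp <= 2 * Lp / vartheta.
  rewrite ler_pdivlMr// mulrC (le_trans (_ : vartheta * Lp <= 1 * Lp))//.
    by rewrite ler_wpM2r//; case/andP: vt01 => _ /ltW.
  by move: Lp0; lra.
rewrite /sigma_max -/D -/fmax -/numax; case: run => _ _ sig0 _ H.
case: k => [|k]; first by rewrite sig0 !le_max lexx !orbT.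
have [_ _ /andP[_ sk] _ _] := H k; apply: (le_trans sk).
rewrite ge_max; apply/andP; split.
  apply: (le_trans (nu_le k.+1)); rewrite ge_max !le_max !lexx !orbT/=.
  by rewrite ?orbT.
apply: (le_trans (mu_le k.+1)); rewrite ge_max !le_max lexx LV !orbT.
by rewrite ?orbT.
Qed.

(** * Counting the long steps of a realization *)

Section CountTrue.
Variables (omega eps : R).
Hypotheses (eps01 : 0 < eps <= 1) (omega01 : 0 < omega < 1).
(** Lower bound on ||s_k||^(p+1) whenever ||s_k||^p >= omega eps. *)
Let a := (omega * eps) `^ (p.+1%:R / p%:R).
(** All sufficiently long steps are counted, whether or not [N1] has been reached, so this dominates
    the number of omega-true iterations. *)
Let N k : R := (\sum_(j < k) (omega * eps <= r j ^+ p)%R)%:R.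

Let a_gt0 : 0 < a.
Proof. by rewrite powR_gt0// mulr_gt0//; [case/andP: omega01|case/andP: eps01]. Qed.

Let NS k : N k.+1 = N k + (omega * eps <= r k ^+ p)%R%:R.
Proof. by rewrite /N big_ord_recr natrD. Qed.

Let nu_count i k : (i <= k)%N -> nu0 * (a * (N k - N i)) <= nu k - nu i.
Proof.
move=> /subnK <-; elim: (k - i)%N => [|j IH].
  by rewrite add0n !subrr !mulr0.
set m := (j + i)%N; rewrite addSn -/m in IH *.
have h : nu0 * (a * (omega * eps <= r m ^+ p)%R%:R) <= nu m * u m.
  have oe : 0 <= omega * eps.
    by rewrite mulr_ge0// ltW//; [case/andP: omega01|case/andP: eps01].
  case: (boolP (omega * eps <= _)) => [t|_] /=; last by rewrite !mulr0 mulr_ge0.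
  rewrite mulr1; apply: ler_pM => //; [exact: ltW|exact: ltW|].
  exact: powR_le_exprS.
rewrite NS nuS (_ : N m + _ - N i = (N m - N i) + (omega * eps <= r m ^+ p)%R%:R);
  last by ring.
rewrite !mulrDr; lra.
Qed.

(** The count is split at the first index where nu is large. Before it, growth of nu up to the
    threshold limits the count; after it, the total growth allowed by the decrease of f does. *)
Lemma count_true_le K :
  (\sum_(j < K) (omega * eps <= r j ^+ p)%R)%:R
  <= (2 * Lp + 2 * D * (fmax - flow)) / (vartheta * nu0 * a) + 1.
Proof.
rewrite -/(N K).
have c0 : 0 < vartheta * nu0 * a by rewrite !mulr_gt0.
have gap : 0 <= fmax - flow.
  by apply: le_trans fmax_gap; rewrite divr_ge0// ?mulr_ge0// ltW.
have N0 : N 0 = 0 by rewrite /N big_ord0.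
have nu00 : nu 0 = nu0 by case: run.
have small_le k : ~~ large k -> N k <= 2 * Lp / (vartheta * nu0 * a).
  rewrite /large -ltNge => sk; have := nu_count (leq0n k); rewrite N0 subr0 nu00.
  move=> h; rewrite ler_pdivlMr//.
  have -> : N k * (vartheta * nu0 * a) = vartheta * (nu0 * (a * N k)) by ring.
  rewrite ltr_pdivlMr// in sk.
  apply: (le_trans (ler_wpM2l (ltW vt0) h)); apply: le_trans (ltW sk).
  by rewrite [leRHS]mulrC ler_wpM2l ?(ltW vt0)// lerBlDr lerDl ltW.
have B0 : 0 <= 2 * D * (fmax - flow) / (vartheta * nu0 * a).
  by rewrite divr_ge0 ?(ltW c0)// !mulr_ge0// ltW.
rewrite [(2 * Lp + _) / _]mulrDl.
have [lK|sK] := boolP (large K); last first.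
  by apply: (le_trans (small_le _ sK)); lra.
have [i [iK li small]] := large_case lK.
(* The extra 1 is the iteration that carries nu across the threshold. *)
have Ni : N i <= 2 * Lp / (vartheta * nu0 * a) + 1.
  case: i {iK li} small => [|i] small.
    by rewrite N0 addr_ge0// divr_ge0 ?(ltW c0)// mulr_ge0.
  by rewrite NS lerD ?small_le ?small// lern1 leq_b1.
have [_ fi] := first_large li small.
have := f_after iK li; have := flow_le (x K) => h1 h2.
have h3 : vartheta / (2 * D) * (nu K - nu i) <= fmax - flow.
  have : 0 <= vartheta * nu0 / D by rewrite divr_ge0 ?mulr_ge0// ltW.
  by lra.
have NK : N K - N i <= 2 * D * (fmax - flow) / (vartheta * nu0 * a).
  rewrite -ler_pdivlMl ?divr_gt0 ?mulr_gt0// in h3.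
  rewrite invf_div mulrAC ler_pdivlMr// in h3.
  rewrite ler_pdivlMr//; apply: le_trans h3.
  rewrite (_ : _ * (vartheta * nu0 * a) = nu0 * (a * (N K - N i)) * vartheta);
    last by ring.
  by rewrite ler_wpM2r ?(ltW vt0)// nu_count.
lra.
Qed.

End CountTrue.

End Run.

(** * Measurability *)

Lemma cvg_floor_grid (R : realType) (y : R) :
  (Num.floor (m.+1%:R * y))%:~R / m.+1%:R @[m --> \oo] --> y.
Proof.
apply/cvgrPdist_lt => e e0; near=> m.
have m0 : 0 < m.+1%:R :> R by [].
have /andP[h1 h2] := floor_itv (m.+1%:R * y).
have y1 : (Num.floor (m.+1%:R * y))%:~R / m.+1%:R <= y.
  by rewrite ler_pdivrMr// [y * _]mulrC.
rewrite ger0_norm ?subr_ge0//.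
apply: (@lt_trans _ _ m.+1%:R^-1); last by near: m; exact: near_infty_natSinv_lt (PosNum e0).
rewrite ltrBlDr -[X in X + _]mul1r -mulrDl ltr_pdivlMr// [y * _]mulrC.
by move: h2; rewrite intrD addrC.
Unshelve. all: by end_near. Qed.

Lemma cvg_cV (R : realType) (n : nat) (u : nat -> 'cV[R]_n) (v : 'cV[R]_n) :
  (forall i, u m i 0 @[m --> \oo] --> v i 0) -> u m @[m --> \oo] --> v.
Proof.
move=> uv A [B vB BA].
have : \forall m \near \oo, forall i : 'I_n, B i 0 (u m i 0).
  by apply: filter_forall => i; exact: uv (vB i 0).
by apply: filterS => m Bm; apply: BA => i j; rewrite ord1.
Qed.

Section Measurability.
Context {R : realType} {d : measure_display} {T : measurableType d}.

Lemma measurable_floor_eq (h : T -> R) (z : int) : measurable_fun setT h ->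
  measurable [set w | Num.floor (h w) = z].
Proof.
move=> mh; have -> : [set w | Num.floor (h w) = z] = h @^-1` `[z%:~R, (z + 1)%:~R[.
  apply/seteqP; split => w /=; rewrite in_itv/=.
    by move=> <-; exact: floor_itv.
  exact: floor_def.
by rewrite -[X in measurable X]setTI; exact: mh.
Qed.

(* g is evaluated on the points of the grid of mesh 1/(m+1), of which there
   are countably many. *)
Lemma measurable_comp_continuous_cV (n : nat) (g : 'cV[R]_n -> R)
    (X : T -> 'cV[R]_n) :
  continuous g -> (forall i, measurable_fun setT (fun w => X w i 0)) ->
  measurable_fun setT (fun w => g (X w)).
Proof.
move=> cg mX.
pose Z m w : {ffun 'I_n -> int} := [ffun i => Num.floor (m.+1%:R * X w i 0)].
pose G m (z : {ffun 'I_n -> int}) : 'cV[R]_n := \col_i ((z i)%:~R / m.+1%:R).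
have cvgX w : G m (Z m w) @[m --> \oo] --> X w.
  apply: cvg_cV => i.
  have -> : (fun m => G m (Z m w) i 0) =
     (fun m => (Num.floor (m.+1%:R * X w i 0))%:~R / m.+1%:R).
    by apply/funext => m; rewrite mxE ffunE.
  exact: cvg_floor_grid.
apply: (@measurable_fun_cvg _ _ _ _ (fun m w => g (G m (Z m w)))); last first.
  by move=> w _; apply: continuous_cvg; [exact: cg | exact: cvgX].
move=> m _ B mB; rewrite setTI.
have -> : (fun w => g (G m (Z m w))) @^-1` B =
  \bigcup_(z in [set z | B (g (G m z))]) [set w | Z m w = z].
  apply/seteqP; split => [w Bw|w [z Bz /= E]]; first by exists (Z m w).
  by rewrite /= E.
rewrite bigcup_mkcond; apply: countable_bigcupT_measurable => [|z].
  exact: countableP.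
case: ifP => _; last exact: measurable0.
have -> : [set w | Z m w = z] =
   \bigcap_(i in [set: 'I_n]) [set w | Num.floor (m.+1%:R * X w i 0) = z i].
  apply/seteqP; split => w /= => [E i _|H]; first by rewrite /= -E ffunE.
  by apply/ffunP => i; rewrite ffunE; exact: (H i).
apply: fin_bigcap_measurable; first exact: finite_finset.
move=> i _; apply: measurable_floor_eq.
by apply: measurable_funM => //; exact: measurable_cst.
Qed.

Lemma measurable_enorm (n : nat) (X : T -> 'cV[R]_n) :
  (forall i, measurable_fun setT (fun w => X w i 0)) ->
  measurable_fun setT (fun w => enorm (X w)).
Proof.
move=> mX; rewrite /enorm.
apply: (@measurableT_comp _ _ _ _ _ _ (@Num.sqrt R)).
  by apply: continuous_measurable_fun; exact: sqrt_continuous.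
by apply: measurable_sum => i; exact: measurable_funX.
Qed.

End Measurability.

(** * Conditional probabilities and the Chernoff bound *)

Section ConditionalProbability.
Context {R : realType} {d : measure_display} {T : measurableType d}.
Variable P : probability T R.

Lemma null_of_integral_neg (C : set T) (h : T -> R) :
  measurable C -> measurable_fun setT h -> (forall w, C w -> h w < 0) ->
  (0 <= \int[P]_(w in C) (h w)%:E)%E -> P C = 0%E.
Proof.
move=> mC mh hneg h0.
have mh' : measurable_fun C (EFin \o h).
  by apply/measurable_EFinP; exact: measurable_funTS.
have I0 : (\int[P]_(w in C) `|(EFin \o h) w| = 0)%E.
  apply/eqP; rewrite eq_le integral_ge0 ?andbT//.
  have E : (\int[P]_(w in C) (h w)%:E = \int[P]_(w in C) - `|(EFin \o h) w|)%E.
    apply: eq_integral => w; rewrite inE => /hneg hw.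
    by rewrite /= ltr0_norm// opprK.
  by move: h0; rewrite E integral_ge0N// oppe_ge0.
have /(ae_eq_integral_abs P mC mh') := I0.
move=> [A [mA A0 CA]]; apply: (subset_measure0 mC mA _ A0).
move=> w Cw; apply: CA => /(_ Cw) /= [hw].
by have := hneg _ Cw; rewrite hw ltxx.
Qed.

(** On C the function c - h is positive, while its integral, c P(C) minus that of h, is at most
    0. *)
Lemma null_of_integral_ge (C : set T) (h : T -> R) (c : R) :
  measurable C -> measurable_fun setT h -> (forall w, C w -> 0 <= h w < c) ->
  (c%:E * P C <= \int[P]_(w in C) (h w)%:E)%E -> P C = 0%E.
Proof.
move=> mC mh hc Ih.
have h0 w : C w -> (0 <= (h w)%:E)%E by move=> /hc /andP[]; rewrite lee_fin.
have g0 w : C w -> (0 <= (c - h w)%:E)%E.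
  by move=> /hc /andP[_ /ltW]; rewrite lee_fin subr_ge0.
have mhC : measurable_fun C (fun w => (h w)%:E).
  by apply/measurable_EFinP; exact: measurable_funTS.
have mg : measurable_fun setT (fun w => c - h w).
  by apply: measurable_funB => //; exact: measurable_cst.
have mgC : measurable_fun C (fun w => (c - h w)%:E).
  by apply/measurable_EFinP; exact: measurable_funTS.
have S : (\int[P]_(w in C) (h w)%:E + \int[P]_(w in C) (c - h w)%:E = c%:E * P C)%E.
  rewrite -ge0_integralD// -[RHS]integral_cst//.
  by apply: eq_integral => w _; rewrite -EFinD addrC subrK.
have Pfin : P C \is a fin_num by exact: fin_num_measure.
have hfin : (\int[P]_(w in C) (h w)%:E)%E \is a fin_num.
  rewrite ge0_fin_numE ?integral_ge0//.
  apply: le_lt_trans (_ : c%:E * P C < +oo)%E.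
    by rewrite -S leeDl// integral_ge0.
  by rewrite ltey_eq fin_numM.
have g_le0 : (\int[P]_(w in C) (c - h w)%:E <= 0)%E.
  by move: Ih; rewrite -S -[X in (_ <= X)%E]adde0 leeD2lE.
apply: (null_of_integral_neg (h := fun w => - (c - h w))) => //.
- exact: measurable_funN.
- by move=> w /hc /andP[_ hw]; rewrite oppr_lt0 subr_gt0.
- have -> : (\int[P]_(w in C) (- (c - h w))%:E =
      \int[P]_(w in C) - (c - h w)%:E)%E by apply: eq_integral.
  by rewrite integral_ge0N// oppe_ge0.
Qed.

Variable G : set (set T).
Hypotheses (GI : setI_closed G) (Gm : G `<=` measurable).

Lemma condprob_version_measurable (A : set T) (q : T -> R) :
  condprob_version P G A q -> measurable_fun setT q.
Proof. by move=> [Gq _] _ B mB; rewrite setTI; apply: Gm; exact: Gq. Qed.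

Lemma condprob_version_itv (A C : set T) (q : T -> R) (i : interval R) :
  condprob_version P G A q -> (forall w, C w <-> q w \in i) -> G C.
Proof.
move=> [Gq _] HC.
have -> : C = q @^-1` [set` i] by apply/seteqP; split => w /= /HC.
by apply: Gq; exact: measurable_itv.
Qed.

(** The set where q is negative belongs to G, and the integral of q over it is a probability, hence
    nonnegative. *)
Lemma condprob_version_neg (A : set T) (q : T -> R) :
  condprob_version P G A q -> P [set w | q w < 0] = 0%E.
Proof.
move=> Aq; have mq := condprob_version_measurable Aq.
have GC : G [set w | q w < 0].
  by apply: (condprob_version_itv (i := `]-oo, 0[) Aq) => w; rewrite in_itv.
case: Aq => Gq Iq; apply: (null_of_integral_neg _ mq) => //; first exact: Gm.
by rewrite -Iq.
Qed.

(** [cond_indep] supplies its own versions q1, q2, q3, which match q only almost everywhere, and D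
    may lie outside G. Up to null sets D is therefore enlarged to a set H of G where q1 >= c and q2
    >= 0; there P(A and E and H) is the integral of q1 q2, at least c times that of q2. *)
Lemma cond_indep_lower_bound (A E D : set T) (q : T -> R) (c : R) : 0 <= c ->
  measurable A -> measurable E -> measurable D ->
  condprob_version P G A q -> (forall w, D w -> c <= q w) ->
  cond_indep P G A E -> (c%:E * P (E `&` D) <= P (A `&` E))%E.
Proof.
move=> c0 mA mE mD Aq Dq [q1 [q2 [q3 [Aq1 Eq2 AEq3 q123]]]].
have mq1 := condprob_version_measurable Aq1.
have mq2 := condprob_version_measurable Eq2.
have mq3 := condprob_version_measurable AEq3.
have n1 := condprob_version_neg Aq1.
have n2 := condprob_version_neg Eq2.
(* Where q is at least c but the other version q1 of the same conditional probability is not: a null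
   set of G. *)
pose C := [set w | c <= q w] `&` [set w | 0 <= q1 w < c].
have GC : G C.
  apply: GI.
    by apply: (condprob_version_itv (i := `[c, +oo[) Aq) => w; rewrite in_itv/= andbT.
  by apply: (condprob_version_itv (i := `[0, c[) Aq1) => w; rewrite in_itv.
have mC := Gm GC.
have C0 : P C = 0%E.
  apply: (null_of_integral_ge mC mq1 (c := c)); first by move=> w [].
  rewrite -Aq1.2// Aq.2// -integral_cst//; apply: ge0_le_integral => //.
  - apply/measurable_EFinP; apply: measurable_funTS.
    exact: condprob_version_measurable Aq.
  - by move=> w [/= cq _]; rewrite lee_fin.
pose H := [set w | c <= q1 w] `&` [set w | 0 <= q2 w].
have GH : G H.
  apply: GI.
    by apply: (condprob_version_itv (i := `[c, +oo[) Aq1) => w; rewrite in_itv/= andbT.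
  by apply: (condprob_version_itv (i := `[0, +oo[) Eq2) => w; rewrite in_itv/= andbT.
have mH := Gm GH.
have mN1 : measurable [set w | q1 w < 0].
  by apply/Gm/(condprob_version_itv (i := `]-oo, 0[) Aq1) => w; rewrite in_itv.
have mN2 : measurable [set w | q2 w < 0].
  by apply/Gm/(condprob_version_itv (i := `]-oo, 0[) Eq2) => w; rewrite in_itv.
have cover : E `&` D `<=` (E `&` H) `|` (C `|` ([set w | q1 w < 0] `|` [set w | q2 w < 0])).
  move=> w [Ew Dw]; have [n2w|p2w] := ltP (q2 w) 0; first by right; right; right.
  have [n1w|p1w] := ltP (q1 w) 0; first by right; right; left.
  have [cq1|q1c] := leP c (q1 w); first by left.
  by right; left; split => /=; [exact: Dq|rewrite p1w].
have PD : (P (E `&` D) <= P (E `&` H))%E.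
  have N0 : P (C `|` ([set w | q1 w < 0] `|` [set w | q2 w < 0])) = 0%E.
    have m12 := measurableU _ _ mN1 mN2.
    have N12 := etrans (measureU0 mN1 mN2 n2) n1.
    exact: etrans (measureU0 mC m12 N12) C0.
  have mN : measurable (C `|` ([set w | q1 w < 0] `|` [set w | q2 w < 0])).
    by apply: measurableU => //; exact: measurableU.
  have mEH : measurable (E `&` H) by exact: measurableI.
  rewrite -(measureU0 mEH mN N0).
  by apply: le_measure => //; rewrite inE//; [exact: measurableI|exact: measurableU].
have PH : (c%:E * P (E `&` H) <= P ((A `&` E) `&` H))%E.
  rewrite (AEq3.2 H GH) (Eq2.2 H GH).
  have mq2H : measurable_fun H (fun w => (q2 w)%:E).
    by apply/measurable_EFinP; exact: measurable_funTS.
  have mq12 : measurable_fun H (fun w => (q1 w * q2 w)%:E).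
    by apply/measurable_EFinP; apply: measurable_funTS; exact: measurable_funM.
  have mq3H : measurable_fun H (fun w => (q3 w)%:E).
    by apply/measurable_EFinP; exact: measurable_funTS.
  have -> : (\int[P]_(w in H) (q3 w)%:E = \int[P]_(w in H) (q1 w * q2 w)%:E)%E.
    apply: ae_eq_integral => //.
    by apply: filterS q123 => w q3w _; rewrite q3w.
  rewrite -ge0_integralZl//; last by move=> w [_ /=]; rewrite lee_fin.
  apply: ge0_le_integral => //.
  - by move=> w [_ /= q2w]; rewrite mule_ge0// lee_fin.
  - exact: measurable_funeM.
  - by move=> w [/= q1w q2w]; rewrite -EFinM lee_fin ler_wpM2r.
apply: (le_trans (lee_wpmul2l _ PD)); first by rewrite lee_fin.
apply: (le_trans PH); apply: le_measure; rewrite ?inE//.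
- by apply: measurableI => //; exact: measurableI.
- exact: measurableI.
Qed.

End ConditionalProbability.

(** The difference of the two sides vanishes at 0 and has derivative - ln(1 - y) - y, nonnegative
    since ln(1 + u) <= u. *)
Lemma entropy_lower_bound (R : realType) (x : R) : 0 <= x -> x < 1 ->
  x ^+ 2 / 2 <= x + (1 - x) * ln (1 - x).
Proof.
move=> x0 x1.
pose g (y : R) := y + (1 - y) * ln (1 - y) - y ^+ 2 / 2.
pose dg (y : R) := - ln (1 - y) - y.
have dE (y : R) : y < 1 -> is_derive y (1 : R) g (dg y).
  move=> y1.
  have y10 : 0 < 1 - y by rewrite subr_gt0.
  have d1 : is_derive y (1 : R) (fun y : R => 1 - y) (- 1).
    have := is_deriveB (is_derive_cst (1 : R) y (1 : R)) (is_derive_id y (1 : R)).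
    by rewrite sub0r.
  have d2 : is_derive y (1 : R) (fun y : R => ln (1 - y)) (- 1 * (1 - y)^-1).
    have := is_derive1_comp (g := fun y : R => 1 - y) (is_derive1_ln y10) d1.
    by move=> H; apply: (is_derive_eq H); rewrite mulrC.
  have d3 := is_deriveM d1 d2.
  have d4 := is_deriveX 2 (is_derive_id y (1 : R)).
  have d5 := is_deriveB (is_deriveD (is_derive_id y (1 : R)) d3)
     (is_deriveZ (2^-1 : R) d4).
  have -> : g = (id + ((fun y : R => 1 - y) * (fun y : R => ln (1 - y))))
      - (2^-1 \*: (id ^+ 2)).
    apply/funext => z; rewrite /g; congr (_ - _).
    by rewrite mulrC.
  apply: (is_derive_eq d5); rewrite /dg.
  rewrite -![_ *: _]/(_ * _) /= expr1.
  field; exact: lt0r_neq0.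
have cg : {within `[0, x], continuous g}.
  apply: derivable_within_continuous => y; rewrite in_itv/= => /andP[_ yx].
  by have [] := dE y (le_lt_trans yx x1).
have dgx (y : R) : y \in `]0, x[ -> is_derive y (1 : R) g (dg y).
  by rewrite in_itv/= => /andP[_ yx]; apply: dE; exact: lt_trans yx x1.
have [c] := MVT_segment x0 dgx cg.
rewrite in_itv/= => /andP[c0 cx].
have -> : g 0 = 0 by rewrite /g subr0 ln1 mulr0 expr0n/= mul0r addr0 subr0.
rewrite !subr0 => E; rewrite -subr_ge0 -/(g x) E mulr_ge0// /dg.
have c1 : c < 1 := le_lt_trans cx x1.
have := @le_ln1Dx R (- c); rewrite ltrN2 => /(_ c1).
lra.
Qed.

(** * Lower tail of the number of occurrences *)

Section Chernoff.
Context {R : realType} {d : measure_display} {T : measurableType d}.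
Variables (P : probability T R) (A : nat -> set T).
Hypothesis mA : forall k, measurable (A k).

Definition occurrences k w : nat := \sum_(j < k) `[< A j w >].

Let L k c := [set w | occurrences k w = c].
Let pr B : R := fine (P B).

Let occ0 w : occurrences 0 w = 0%N.
Proof. by rewrite /occurrences big_ord0. Qed.

Let occS k w : occurrences k.+1 w = (occurrences k w + `[< A k w >])%N.
Proof. by rewrite /occurrences big_ord_recr. Qed.

Lemma occurrences_le k w : (occurrences k w <= k)%N.
Proof.
elim: k => [|k IH]; first by rewrite occ0.
by rewrite occS -addn1 leq_add// leq_b1.
Qed.

Let L_S0 k : L k.+1 0 = L k 0 `\` A k.
Proof.
apply/seteqP; split => w; rewrite /L /= occS.
  move=> /eqP; rewrite addn_eq0 => /andP[/eqP -> /eqP].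
  by case: asboolP.
by move=> [-> nA]; case: asboolP.
Qed.

Let L_SS k c : L k.+1 c.+1 = (L k c.+1 `\` A k) `|` (L k c `&` A k).
Proof.
apply/seteqP; split => w; rewrite /L /= occS.
  by case: asboolP => Aw /eqP; rewrite ?addn1 ?eqSS ?addn0 => /eqP; [right|left].
by move=> [[-> nA]|[-> Aw]]; case: asboolP => // _; rewrite ?addn0 ?addn1.
Qed.

(** Stated for any sigma-algebra G: it gives measurability of the level sets and also places them in
    the sigma-algebra generated by the earlier events, as conditional independence requires. *)
Lemma occurrences_level_sub (G : set (set T)) k c :
  sigma_algebra setT G -> (forall j, (j < k)%N -> G (A j)) ->
  G [set w | occurrences k w = c].
Proof.
move=> [G0 GC GU].
have GN X : G X -> G (~` X) by move=> /GC; rewrite setTD.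
have GU2 X Y : G X -> G Y -> G (X `|` Y).
  move=> GX GY; rewrite -bigcup2E; apply: GU => -[|[|m]] //=.
have GI X Y : G X -> G Y -> G (X `&` Y).
  by move=> GX GY; rewrite -[X `&` Y]setCK setCI; apply/GN/GU2; exact/GN.
elim: k c => [|k IH] c GA.
  case: c => [|c].
    rewrite (_ : [set _ | _] = ~` set0); first exact: GN.
    by rewrite setC0; apply/seteqP; split => w //= _; rewrite occ0.
  rewrite (_ : [set _ | _] = set0)//.
  by apply/seteqP; split => w //=; rewrite occ0.
have Lk c' : G (L k c') by apply: IH => j jk; apply: GA; exact: ltnW.
case: c => [|c]; rewrite -/(L _ _) ?L_S0 ?L_SS.
  by rewrite setDE; apply: GI => //; apply/GN/GA.
apply: GU2; last by apply: GI => //; exact: GA.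
by rewrite setDE; apply: GI => //; apply/GN/GA.
Qed.

Let mL k c : measurable (L k c).
Proof.
apply: (@occurrences_level_sub measurable) => //.
by split => [|X mX|F mF]; [exact: measurable0|exact: measurableD|exact: bigcupT_measurable].
Qed.

(* The expectation of z ^ occurrences k on the event B. *)
Let S k (B : set T) (z : R) : R := \sum_(c < k.+1) z ^+ c * pr (B `&` L k c).

Let prU X Y : measurable X -> measurable Y -> X `&` Y = set0 ->
  pr (X `|` Y) = pr X + pr Y.
Proof.
move=> mX mY XY; rewrite /pr measureU// fineD//; exact: fin_num_measure.
Qed.

Let pr_le X Y : measurable X -> measurable Y -> X `<=` Y -> pr X <= pr Y.
Proof.
move=> mX mY XY; apply: fine_le; [exact: fin_num_measure|exact: fin_num_measure|].
by apply: le_measure; rewrite ?inE.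
Qed.

Let pr_ge0 X : 0 <= pr X.
Proof. exact: fine_ge0. Qed.

Let S_split k B C z : measurable B -> measurable C ->
  S k B z = S k (B `\` C) z + S k (B `&` C) z.
Proof.
move=> mB mC; rewrite /S -big_split; apply: eq_bigr => c _ /=.
rewrite -mulrDr; congr (_ * _); rewrite -prU.
- by congr pr; rewrite -setIUl; congr (_ `&` _); rewrite setDE -setIUr setvU setIT.
- by apply: measurableI => //; exact: measurableD.
- by apply: measurableI => //; exact: measurableI.
- by apply/seteqP; split => w //= [[[_ nC] _] [[_ /nC]]].
Qed.

Let S_le k B C z : 0 <= z -> measurable B -> measurable C -> B `<=` C ->
  S k B z <= S k C z.
Proof.
move=> z0 mB mC BC; apply: ler_sum => c _; rewrite ler_wpM2l ?exprn_ge0//.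
by apply: pr_le; [exact: measurableI|exact: measurableI|exact: setSI].
Qed.

Let S_succ k B z : measurable B ->
  S k.+1 B z = S k (B `\` A k) z + z * S k (B `&` A k) z.
Proof.
move=> mB.
(* [S k] stops at level k, whereas the expansion of [S k.+1] reaches level k + 1, which k events
   cannot attain. *)
have empty X : pr (X `&` L k k.+1) = 0.
  rewrite (_ : _ `&` _ = set0); first by rewrite /pr measure0.
  apply/seteqP; split => w //= [_]; rewrite /L /= => E.
  by have := occurrences_le k w; rewrite E ltnn.
rewrite {1}/S big_ord_recl expr0 mul1r L_S0.
have -> : B `&` (L k 0 `\` A k) = (B `\` A k) `&` L k 0.
  by rewrite !setDE setIA setIAC.
under eq_bigr => i _.
  rewrite lift0 L_SS.
  have -> : pr (B `&` ((L k i.+1 `\` A k) `|` (L k i `&` A k))) =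
     pr ((B `\` A k) `&` L k i.+1) + pr ((B `&` A k) `&` L k i).
    rewrite -prU.
    - by congr pr; rewrite setIUr !setDE !setIA [B `&` _ `&` ~` _]setIAC
         [B `&` L k i `&` _]setIAC.
    - by apply: measurableI => //; exact: measurableD.
    - by apply: measurableI => //; exact: measurableI.
    - by apply/seteqP; split => w //= [[[_ nA] _] [[_ /nA]]].
  rewrite mulrDr; over.
rewrite big_split/= addrA; congr (_ + _).
  rewrite big_ord_recr/= empty mulr0 addr0 /S big_ord_recl expr0 mul1r.
  by congr (_ + _); apply: eq_bigr => i _; rewrite lift0.
rewrite /S mulr_sumr; apply: eq_bigr => i _.
by rewrite exprS mulrA.
Qed.

Let S1 k B : measurable B -> S k B 1 = pr B.
Proof.
elim: k B => [|k IH] B mB.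
  rewrite /S big_ord1 expr0 mul1r; congr pr; rewrite -[RHS]setIT; congr (_ `&` _).
  by apply/seteqP; split => w //= _; rewrite /L /= occ0.
have mD := measurableD mB (mA k); have mI := measurableI _ _ mB (mA k).
rewrite S_succ// mul1r !IH// -prU//.
  by congr pr; rewrite setDE -setIUr setvU setIT.
by apply/seteqP; split => w //= [[_ nA] [_ /nA]].
Qed.

Variables (D : nat -> set T) (c : R).
Hypotheses (mD : forall k, measurable (D k)) (Dnincr : forall k, D k.+1 `<=` D k).
Hypotheses (AD : forall k, A k `<=` D k) (c0 : 0 <= c).
Hypothesis cA : forall k E, <<s [set A j | j in [set j : nat | (j < k)%N]] >> E ->
  measurable E -> (c%:E * P (E `&` D k) <= P (A k `&` E))%E.

Let S_A k z : 0 <= z -> c * S k (D k) z <= S k (A k) z.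
Proof.
move=> z0; rewrite /S mulr_sumr; apply: ler_sum => i _.
rewrite mulrCA ler_wpM2l ?exprn_ge0//.
have := @cA k (L k i); rewrite setIC => /(_ _ (mL k i)) h.
rewrite -lee_fin EFinM !fineK; first last.
- by apply: fin_num_measure; exact: measurableI.
- by apply: fin_num_measure; exact: measurableI.
apply: h; apply: occurrences_level_sub; first exact: smallest_sigma_algebra.
by move=> j jk; apply: sub_sigma_algebra; exists j.
Qed.

(** An occurrence of A k multiplies z^count by z, so the expectation drops by (1 - z) times its part
    on A k, which is at least c times the whole. Then 1 - y <= exp(- y). *)
Let S_D k z : 0 <= z -> z <= 1 ->
  S k.+1 (D k) z <= expR (- (c * (1 - z))) * S k (D k) z.
Proof.
move=> z0 z1; rewrite S_succ//.
have -> : D k `&` A k = A k by rewrite setIC; apply/setIidPl.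
have := S_split k z (mD k) (mA k).
rewrite (_ : D k `&` A k = A k); last by rewrite setIC; apply/setIidPl.
have SA := S_A k z0.
have SD0 : 0 <= S k (D k) z.
  by rewrite sumr_ge0// => i _; rewrite mulr_ge0 ?exprn_ge0.
move=> E.
have h1 : S k (D k `\` A k) z + z * S k (A k) z = S k (D k) z - (1 - z) * S k (A k) z.
  by rewrite E; ring.
rewrite h1.
have h2 : (1 - z) * (c * S k (D k) z) <= (1 - z) * S k (A k) z.
  by rewrite ler_wpM2l// subr_ge0.
have h3 : (1 + - (c * (1 - z))) * S k (D k) z <= expR (- (c * (1 - z))) * S k (D k) z.
  by rewrite ler_wpM2r// expR_ge1Dx.
apply: le_trans h3; rewrite [leRHS]mulrDl mul1r mulNr lerD2l lerN2.
by apply: le_trans h2; rewrite mulrA [(1 - z) * c]mulrC.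
Qed.

(** Since D decreases, passing from [D k] to [D k.+1] can only lower the expectation, and the
    factors multiply. *)
Let S_bound k z : 0 <= z -> z <= 1 ->
  S k.+1 (D k) z <= expR (- (c * (1 - z)) * k.+1%:R).
Proof.
move=> z0 z1; elim: k => [|k IH].
  apply: (le_trans (S_D 0 z0 z1)); rewrite mulr1 ler_piMr ?expR_ge0//.
  rewrite /S big_ord1 expr0 mul1r -[leRHS]/(fine 1%E).
  apply: fine_le => //; first by apply: fin_num_measure; exact: measurableI.
  by apply: probability_le1; exact: measurableI.
apply: (le_trans (S_D k.+1 z0 z1)).
have -> : - (c * (1 - z)) * k.+2%:R = - (c * (1 - z)) + - (c * (1 - z)) * k.+1%:R.
  by rewrite -[k.+2%:R]natr1; ring.
rewrite expRD ler_wpM2l ?expR_ge0//.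
by apply: le_trans IH; apply: S_le.
Qed.

(** Take z = 1 - delta. The count is at most m everywhere on [D K], so z^m P(D K) is at most the
    expectation of z^count on [D K]; the bound on m and the entropy inequality give the exponent. *)
Lemma chernoff_lower_tail K (m delta : R) : 0 < delta < 1 ->
  (forall w, D K w -> (occurrences K.+1 w)%:R <= m) ->
  m <= (1 - delta) * c * K.+1%:R ->
  (P (D K) <= (expR (- (delta ^+ 2 / 2) * c * K.+1%:R))%:E)%E.
Proof.
move=> /andP[d0 d1] occ_m mK.
have z0 : 0 < 1 - delta by rewrite subr_gt0.
have z1 : 1 - delta <= 1 by rewrite lerBlDr lerDl ltW.
rewrite -(fineK (fin_num_measure P _ (mD K))) lee_fin -/(pr _).
have SB := S_bound K (ltW z0) z1.
have LB : expR (m * ln (1 - delta)) * pr (D K) <= S K.+1 (D K) (1 - delta).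
  rewrite -(S1 K.+1 (mD K)) /S mulr_sumr; apply: ler_sum => i _.
  rewrite expr1n mul1r.
  (* The bound on the count is usable only at levels that meet [D K]; the other terms vanish. *)
  have [/= [w [Dw Lw]]|n0] := pselect (D K `&` L K.+1 i !=set0); last first.
    rewrite (_ : D K `&` L K.+1 i = set0) ?/pr ?measure0 ?mulr0//.
    by apply/eqP; apply/negP => /negP /set0P.
  rewrite ler_wpM2r// -[leRHS]lnK ?posrE ?exprn_gt0// ler_expR lnXn//.
  rewrite -mulr_natl; apply: ler_wnM2r; first by rewrite ln_le0.
  by have := occ_m w Dw; rewrite Lw.
have lnd : ln (1 - delta) <= 0 by rewrite ln_le0.
have ent := entropy_lower_bound (ltW d0) d1.
have := le_trans LB SB; rewrite -ler_pdivlMl ?expR_gt0// -expRN -expRD.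
move=> /le_trans; apply; rewrite ler_expR.
have h1 : (1 - delta) * c * K.+1%:R * ln (1 - delta) <= m * ln (1 - delta).
  by rewrite ler_wnM2r.
have h2 : c * K.+1%:R * (delta ^+ 2 / 2)
    <= c * K.+1%:R * (delta + (1 - delta) * ln (1 - delta)).
  by rewrite ler_wpM2l// mulr_ge0.
move: h1 h2; rewrite subKr; move: (ln _) => y h1 h2.
apply: (@le_trans _ _ (- (c * K.+1%:R * (delta + (1 - delta) * y)))).
  move: h1; rewrite mulrDr.
  have -> : c * K.+1%:R * ((1 - delta) * y) = (1 - delta) * c * K.+1%:R * y by ring.
  have -> : - (c * delta) * K.+1%:R = - (c * K.+1%:R * delta) by ring.
  lra.
by rewrite -(mulrA (- _)) mulNr lerN2 mulrC.
Qed.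

End Chernoff.

(** * Complexity bound *)

Section HittingTime.
Context {R : realType} {n : nat} (f : 'cV[R]_n -> R) (eps : R).

Lemma le_N1P (x : nat -> 'cV[R]_n) k :
  (k%:R%:E <= N1 f x eps)%E <-> (forall j, (j < k)%N -> eps < enorm (grad f (x j))).
Proof.
split=> [kN j jk|H].
  rewrite ltNge; apply/negP => gj.
  have jN : (N1 f x eps <= j%:R%:E)%E by apply: ereal_inf_lbound; exists j.
  by have := le_trans kN jN; rewrite lee_fin ler_nat leqNgt jk.
apply: le_ereal_inf_tmp => _ [j gj <-]; rewrite lee_fin ler_nat leqNgt.
by apply/negP => /H; rewrite ltNge gj.
Qed.

(** [N1] is an integer or infinite, so exceeding Z means being at least k + 1, with k the integer
    part of Z. *)
Lemma N1_le_setC (T : Type) (x : T -> nat -> 'cV[R]_n) (Z : R) k :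
  k%:R <= Z < k.+1%:R ->
  [set w | (N1 f (x w) eps <= Z%:E)%E] =
  ~` [set w | (k.+1%:R%:E <= N1 f (x w) eps)%E].
Proof.
move=> /andP[kZ Zk]; apply/seteqP; split => w /=.
  by move=> NZ kN; have := le_trans kN NZ; rewrite lee_fin leNgt Zk.
move=> kN; have [j jk gj] : exists2 j, (j < k.+1)%N & enorm (grad f (x w j)) <= eps.
  apply: contrapT => H; apply: kN; apply/le_N1P => j jk.
  by rewrite ltNge; apply/negP => gj; apply: H; exists j.
apply: (@le_trans _ _ j%:R%:E); first by apply: ereal_inf_lbound; exists j.
by rewrite lee_fin (le_trans _ kZ)// ler_nat.
Qed.

End HittingTime.

Lemma measurable_preimage_itv (R : realType) (d : measure_display)
    (T : measurableType d) (h : T -> R) (C : set T) (i : interval R) :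
  measurable_fun setT h -> (forall w, C w <-> h w \in i) -> measurable C.
Proof.
move=> mh HC; have -> : C = setT `&` h @^-1` [set` i].
  by rewrite setTI; apply/seteqP; split => w /= /HC.
exact: mh.
Qed.

Section RunEvents.
Context {R : realType} {d : measure_display} {T : measurableType d}.
Context {n l p : nat} (f : 'cV[R]_n -> R) (eps : R).
Variables (x : T -> nat -> 'cV[R]_n).
Hypotheses (Cf : Cp p f) (p0 : (0 < p)%N).
Hypothesis mx : forall k (i : 'I_n), measurable_fun setT (fun w => x w k i 0).

Lemma measurable_le_N1 k : measurable [set w | (k%:R%:E <= N1 f (x w) eps)%E].
Proof.
have -> : [set w | (k%:R%:E <= N1 f (x w) eps)%E] =
    \bigcap_(j in `I_k) [set w | eps < enorm (grad f (x w j))].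
  by apply/seteqP; split => w; [move/le_N1P|move=> H; apply/le_N1P].
apply: fin_bigcap_measurable; first exact: finite_II.
move=> j _.
apply: (@measurable_preimage_itv _ _ _ (fun w => enorm (grad f (x w j)))
  _ `]eps, +oo[); last by move=> w; rewrite in_itv/= andbT.
apply: measurable_enorm => i.
apply: (@measurable_comp_continuous_cV _ _ _ _ (fun z => grad f z i 0)) => //.
have -> : (fun z => grad f z i 0) = dderiv [:: delta_mx i 0] f.
  by apply/funext => z; rewrite mxE.
by have [] := Cf (vs := [:: delta_mx i 0]) p0.
Qed.

Lemma measurable_omega_true (S : T -> nat -> 'M[R]_(l, n))
    (sh : T -> nat -> 'cV[R]_l) (omega : R) k :
  (forall k (i : 'I_l) (j : 'I_n), measurable_fun setT (fun w => S w k i j)) ->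
  (forall k (i : 'I_l), measurable_fun setT (fun w => sh w k i 0)) ->
  measurable (omega_true f p x S sh eps omega k).
Proof.
move=> mS msh.
have -> : omega_true f p x S sh eps omega k =
   [set w | (k.+2%:R%:E <= N1 f (x w) eps)%E] `&`
   [set w | omega * eps <= enorm ((S w k)^T *m sh w k) ^+ p] by [].
apply: measurableI; first exact: measurable_le_N1.
apply: (@measurable_preimage_itv _ _ _
  (fun w => enorm ((S w k)^T *m sh w k) ^+ p) _ `[omega * eps, +oo[); last first.
  by move=> w; rewrite in_itv/= andbT.
apply: measurable_funX; apply: measurable_enorm => i.
under eq_fun => w do rewrite mxE.
apply: measurable_sum => j; apply: measurable_funM => //.
under eq_fun => w do rewrite mxE.
exact: mS.
Qed.

End RunEvents.

Lemma sigma_gen_xs_measurable (R : realType) (d : measure_display)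
    (T : measurableType d) (n : nat) (X : T -> 'cV[R]_n) (sg : T -> R) :
  (forall i, measurable_fun setT (fun w => X w i 0)) -> measurable_fun setT sg ->
  sigma_gen_xs X sg `<=` measurable.
Proof.
move=> mX msg; apply: smallest_sub.
  by split => [|B mB|F mF]; [exact: measurable0|exact: measurableD|exact: bigcupT_measurable].
move=> _ [[i [B [mB ->]]]|[B [mB ->]]]; rewrite -[X in measurable X]setTI.
  exact: mX.
exact: msg.
Qed.

Lemma sqr_onem_le (R : realFieldType) (x : R) : 0 <= x <= 1 ->
  (1 - x) ^+ 2 <= 1 - x.
Proof.
move=> /andP[x0 x1]; rewrite expr2 ler_piMr ?subr_ge0//.
by rewrite lerBlDr lerDl.
Qed.

Theorem mainTheorem9
  (R : realType) (d : measure_display) (T : measurableType d)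
  (P : probability T R)
  (n l p : nat) (f : 'cV[R]_n -> R) (x0 : 'cV[R]_n)
  (nu0 eps theta mum1 vartheta : R)
  (Lp flow kg khigh omega piS delta1 : R)
  (* the (random) quantities generated by the algorithm *)
  (x : T -> nat -> 'cV[R]_n) (S : T -> nat -> 'M[R]_(l, n))
  (sh : T -> nat -> 'cV[R]_l) (sigma nu mu kS : T -> nat -> R) :
  (l < n)%N -> (1 <= p)%N ->
  0 < nu0 -> 0 < eps <= 1 -> 1 < theta -> 0 <= mum1 -> 0 < vartheta < 1 ->
  0 <= Lp -> 0 <= kg -> 0 <= khigh ->
  0 < omega < 1 -> 0 < piS -> 0 < delta1 < 1 ->
  AS1 p f -> AS2 f flow -> AS3 p f Lp -> AS4 f kg -> AS5 p f khigh ->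
  (* every realization is a run of SKOFFARp *)
  (forall w, skoffar_run f p x0 nu0 theta mum1 vartheta
               (x w) (S w) (sh w) (sigma w) (nu w) (mu w) (kS w)) ->
  (* all these quantities are random variables *)
  (forall k (i : 'I_n), measurable_fun setT (fun w => x w k i 0)) ->
  (forall k (i : 'I_l) (j : 'I_n), measurable_fun setT (fun w => S w k i j)) ->
  (forall k (i : 'I_l), measurable_fun setT (fun w => sh w k i 0)) ->
  (forall k, measurable_fun setT (fun w => sigma w k)) ->
  (forall k, measurable_fun setT (fun w => nu w k)) ->
  (forall k, measurable_fun setT (fun w => mu w k)) ->
  (forall k, measurable_fun setT (fun w => kS w k)) ->
  (* the S_k are drawn independently from one fixed distribution *)
  iid_sketches P S ->
  AS6 P f p x S sh sigma eps omega piS vartheta nu0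
      (sigma_max (f x0) flow p Lp kg khigh vartheta nu0 mum1) ->
  (((1 - expR (- (delta1 ^+ 2 / 2) * piS
                  * (k_diamond p Lp vartheta nu0 omega eps delta1 piS)%:~R))
     ^+ 2)%:E
   <= P [set w | (N1 f (x w) eps
                  <= (kappa_SKOFFARp (f x0) flow p Lp kg khigh vartheta nu0
                        omega delta1 piS
                      * eps `^ (- (p.+1%:R / p%:R)) + 4)%:E)%E])%E.

Proof.
move=> _ p0 nu0_gt0 eps01 _ _ vt01 Lp0 kg0 kh0 omega01 pi0 delta01
  Cf flow_le fL fkg fkh run mx mS msh msigma _ _ _ _ [prob_true indep].
set q : R := p.+1%:R / p%:R.
set kappa := kappa_SKOFFARp _ _ _ _ _ _ _ _ _ _ _.
set kd : R := (k_diamond _ _ _ _ _ _ _ _)%:~R.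
set Z : R := _ + 4.
have [vt_gt0 vt_lt1] := andP vt01.
have [eps_gt0 eps_le1] := andP eps01.
have [om_gt0 om_lt1] := andP omega01.
have [d_gt0 d_lt1] := andP delta01.
pose gap := f_max (f x0) p Lp kg khigh vartheta nu0 - flow.
pose F : R := (p.+1)`!%:R.
have F_gt0 : 0 < F by rewrite ltr0n fact_gt0.
pose a := (omega * eps) `^ q.
have a_gt0 : 0 < a by rewrite powR_gt0// mulr_gt0.
have q_ge0 : 0 <= q by rewrite divr_ge0.
have a_le1 : a <= 1.
  have oe1 : omega * eps <= 1 by rewrite mulr_ile1// ltW.
  have oe0 : 0 <= omega * eps by rewrite mulr_ge0// ltW.
  have o1 : 1 `^ q = 1 :> R by rewrite powR1.
  by rewrite -o1 ge0_ler_powR// nnegrE.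
have aE : a = omega `^ q * eps `^ q by rewrite /a powRM// ltW.
pose X := vartheta * nu0 * a.
have X_gt0 : 0 < X by rewrite !mulr_gt0.
(* [A0] bounds the omega-true iterations before nu is large, up to one, and [B0] those after. *)
pose A0 := 2 * Lp / X.
pose B0 := 2 * F * gap / X.
pose c := (1 - delta1) * piS.
have c_gt0 : 0 < c by rewrite mulr_gt0// subr_gt0.
(* [fmax_gap] has a deterministic conclusion but is derived from a run; total mass 1 provides a
   realization. *)
have [w0 _] : exists w0 : T, True.
  apply: contrapT => noT; have := probability_setT P.
  rewrite (_ : [set: T] = set0) ?measure0.
    by move=> /eqP; rewrite eq_sym onee_eq0.
  by apply/seteqP; split => w //= _; apply: noT; exists w.
have gap_ge := fmax_gap p0 nu0_gt0 vt01 Lp0 kg0 kh0 Cf flow_le fkg fkh (run w0).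
have A0_ge0 : 0 <= A0 by rewrite divr_ge0 ?mulr_ge0// ltW.
(* From gap >= vartheta nu0 / (p+1)! and a <= 1. This is what absorbs the additive constants
   below. *)
have B0_ge2 : 2 <= B0.
  rewrite ler_pdivlMr// -(mulrA 2 F) ler_pM2l// /X.
  move: gap_ge; rewrite -/gap -/F ler_pdivrMr// [gap * _]mulrC; apply: le_trans.
  by rewrite ler_piMr// mulr_ge0// ltW.
have epsN : eps `^ (- q) = (eps `^ q)^-1 by rewrite powRN.
have ZE : Z = 2 * (A0 + B0) / c + 4.
  rewrite /Z /kappa /kappa_SKOFFARp -/q -/gap -/F epsN /A0 /B0 /X aE /c.
  congr (_ + 4).
  have d1 : 1 - delta1 != 0 by rewrite subr_eq0 eq_sym lt_eqF.
  field; rewrite d1 !gt_eqF ?powR_gt0//.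
pose K := Num.truncn Z.
have Z_ge0 : 0 <= Z by rewrite ZE addr_ge0// divr_ge0 ?(ltW c_gt0)// mulr_ge0// addr_ge0//; lra.
have KZ : K%:R <= Z < K.+1%:R by exact: truncn_itv.
have [KZ1 KZ2] := andP KZ.
have K_lb : 2 * (A0 + B0) / c + 3 < K%:R.
  by move: KZ2; rewrite ZE -natr1; lra.
have K_gt0 : (0 < K)%N.
  rewrite -(ltr0n R); apply: le_lt_trans K_lb.
  by rewrite addr_ge0// divr_ge0 ?(ltW c_gt0)// mulr_ge0// addr_ge0//; lra.
(* With this shift [D k] is the event N1 >= K + 1, and [occurrences Tk k.+1] covers exactly K
   iterations. *)
pose k := K.-1; have Kk : K = k.+1 by rewrite prednK.
pose D i := [set w | ((i.+2)%:R%:E <= N1 f (x w) eps)%E].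
pose Tk := omega_true f p x S sh eps omega.
have mD i : measurable (D i) by exact: (measurable_le_N1 eps Cf p0 mx).
have mTk i : measurable (Tk i) by exact: (measurable_omega_true eps Cf p0 mx omega i mS msh).
have step i (E : set T) : <<s [set Tk j | j in [set j : nat | (j < i)%N]] >> E ->
    measurable E -> (piS%:E * P (E `&` D i) <= P (Tk i `&` E))%E.
  move=> GE mE; have [pq [cpq pq_ge]] := prob_true i.
  have [_ _ _ GI] := (sigma_algebraP (fun _ _ => subsetT _)).1
     (smallest_sigma_algebra setT _ : sigma_algebra setT (sigma_gen_xs (x^~ i) (sigma^~ i))).
  apply: (cond_indep_lower_bound GI _ (ltW pi0) (mTk i) mE (mD i) cpq _ (indep i E GE)).
    exact: sigma_gen_xs_measurable.
  move=> w Dw; apply: pq_ge => //; apply/andP; split.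
    exact: sigma_ge nu0_gt0 vt01 (run w) i.
  exact: (sigma_le p0 nu0_gt0 vt01 Lp0 kg0 kh0 Cf flow_le fL fkg fkh (run w)).
have Dnincr i : D i.+1 `<=` D i.
  by move=> w; apply: le_trans; rewrite lee_fin ler_nat.
have TD i : Tk i `<=` D i by move=> w [].
have occ w : D k w -> (occurrences Tk k.+1 w)%:R <= A0 + B0 + 1.
  move=> _; have := count_true_le p0 nu0_gt0 vt01 Lp0 kg0 kh0 Cf flow_le fL fkg
    fkh (run w) eps01 omega01 k.+1.
  rewrite -/F -/gap -/q -/a -/X mulrDl -/A0 -/B0; apply: le_trans.
  rewrite ler_nat; apply: leq_sum => j _.
  by case: asboolP => // -[_ ->].
(* K exceeds 2 (A0 + B0) / c + 3, and A0 + B0 >= 2, so the doubling covers the extra 1. *)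
have mK : A0 + B0 + 1 <= (1 - delta1) * piS * k.+1%:R.
  rewrite -Kk -/c; have : c * (2 * (A0 + B0) / c + 3) <= c * K%:R.
    by rewrite ler_pM2l// ltW.
  rewrite mulrDr mulrC divfK ?gt_eqF//; lra.
have PD := chernoff_lower_tail mTk mD Dnincr TD (ltW pi0) step delta01 occ mK.
have ceil_le (y : R) : (Num.ceil y)%:~R <= y + 1.
  by have /andP[+ _] := ceil_itv y; rewrite intrB ltrBlDr => /ltW.
have ceil_pos (y : R) : 0 <= y -> 0 <= (Num.ceil y)%:~R :> R.
  by move=> y0; rewrite ler0z ceil_ge0 (lt_le_trans _ y0)// ltrN10.
have kd_ge0 : 0 <= kd.
  apply/ceil_pos; rewrite divr_ge0 ?(ltW c_gt0)// ceil_pos// divr_ge0//.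
    by rewrite !mulr_ge0// powR_ge0.
  by rewrite !mulr_ge0 ?powR_ge0// ltW.
(* The two ceilings give at most (A0 + 1) / c + 1, and A0 + 1 <= 2 (A0 + B0). *)
have kd_le : kd <= K%:R.
  apply: (le_trans _ (ltW K_lb)).
  have ks : (k_star p Lp vartheta nu0 omega eps)%:~R <= A0 + 1.
    rewrite /k_star -/q epsN.
    have -> : 2 * Lp * (eps `^ q)^-1 / (vartheta * nu0 * omega `^ q) = A0.
      by rewrite /A0 /X aE; field; rewrite !gt_eqF ?powR_gt0.
    exact: ceil_le.
  have h1 : kd <= (k_star p Lp vartheta nu0 omega eps)%:~R / c + 1.
    exact: ceil_le.
  have h2 : (k_star p Lp vartheta nu0 omega eps)%:~R / c <= 2 * (A0 + B0) / c.
    by rewrite ler_pM2r ?invr_gt0//; lra.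
  lra.
rewrite (N1_le_setC f eps x KZ) Kk -/(D k) probability_setC//.
set E := expR _.
have E01 : 0 <= E <= 1.
  rewrite expR_ge0/= -(expR0 R) ler_expR !mulNr oppr_le0.
  by rewrite !mulr_ge0// ?divr_ge0 ?exprn_ge0// ltW.
apply: (@le_trans _ _ (1 - E)%:E); first by rewrite lee_fin sqr_onem_le.
rewrite EFinB; apply: leeB => //; apply: (le_trans PD).
rewrite lee_fin ler_expR -Kk !mulNr lerN2 ler_wpM2l//.
by rewrite mulr_ge0// ?divr_ge0 ?exprn_ge0// ltW.
Qed.
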